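(* Let $(X,\varphi)$ and $(Y,\psi)$ be Cantor minimal systems. The following statements are equivalent: (1) there is a factor map from $(X,\varphi)$ to $(Y,\psi)$; (2) there are Bratteli–Vershik models $C$ and $B$ for $(X,\varphi)$ and $(Y,\psi)$, respectively, such that there is an ordered premorphism from $B$ to $C$.
   Context: A Cantor minimal system $(X,\varphi)$ is a minimal homeomorphism $\varphi$ of a space $X$ homeomorphic to the Cantor set. A factor map $(X,\varphi)\to(Y,\psi)$ is a continuous surjection $\alpha:X\to Y$ with $\alpha\circ\varphi=\psi\circ\alpha$; a conjugacy is a factor map that is a homeomorphism. **Bratteli diagrams.** A Bratteli diagram $(V,E)$ consists of a vertex set $V=V_0\sqcup V_1\sqcup\cdots$ with each $V_n$ finite and non-empty and $V_0$ a singleton, and an edge set $E=E_1\sqcup E_2\sqcup\cdots$ with each $E_n$ finite and non-empty, together with maps $r,s:E\to V$ (range, source) such that $r(E_n)\subseteq V_n$, $s(E_n)\subseteq V_{n-1}$, $s^{-1}\{v\}\neq\varnothing$ for all $v\in V$ and $r^{-1}\{v\}\ne\varnothing$ for all $v\in V\setminus V_0$. An ordered Bratteli diagram $(V,E,\geq)$ is a Bratteli diagram with a partial order on $E$ such that $e,e'$ are comparable iff $r(e)=r(e')$. It is properly ordered if there is exactly one infinite path $x_{\max}=(e_1,e_2,\ldots)$ ($e_i\in E_i$, $r(e_i)=s(e_{i+1})$) consisting of maximal edges, and exactly one, $x_{\min}$, consisting of minimal edges. For $B$ properly ordered, $X_B$ is the space of infinite paths, with the cylinder sets as a basis of the topology,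 and the Vershik homeomorphism $\lambda_B$ is given by $\lambda_B(x_{\max})=x_{\min}$ and, for other $x=(e_1,e_2,\ldots)$, with $k$ least such that $e_k$ is not maximal, $f_k$ the successor of $e_k$ in $r^{-1}\{r(e_k)\}$ and $(f_1,\ldots,f_{k-1})$ the path of minimal edges from $V_0$ to $s(f_k)$, by $\lambda_B(x)=(f_1,\ldots,f_k,e_{k+1},\ldots)$. A Bratteli–Vershik model for $(X,\varphi)$ is a properly ordered Bratteli diagram $B$ such that $(X_B,\lambda_B)$ is conjugate to $(X,\varphi)$. **Edge sets.** An ordered edge set from a finite set $S$ to a finite set $T$ is a finite set $F$ with maps $s:F\to S$, $r:F\to T$ and a linear order on each $r^{-1}\{w\}$, $w\in T$. If $G$ is an ordered edge set from $T$ to $U$, then $F\circ G=\{(e,g)\in F\times G: r(e)=s(g)\}$, with source $s(e)$, range $r(g)$, and order: for $r(g)=r(g')$, $(e,g)<(e',g')$ iff $g<g'$, or $g=g'$ and $e<e'$. Write $F\cong F'$ if there is a bijection $F\to F'$ preserving sources, ranges and order. For $k<l$, $E_{k,l}=E_{k+1}\circ\cdots\circ E_l$; $E_{k,k}$ consists of one edge from $v$ to $v$ for each $v\in V_k$. **Ordered premorphisms.** An ordered premorphism $f:B=(V,E,\ge)\to C=(W,S,\ge)$ is a triple $(F,(f_n)_{n\ge0},\geq)$ where $(f_n)$ is an unbounded sequence of integers with $0=f_0\le f_1\le\cdots$, and $F=F_0\sqcup F_1\sqcup\cdots$ where each $F_n$ is a non-empty finite ordered edge set from $V_n$ to $W_{f_n}$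 such that every $v\in V_n$ is the source and every $w\in W_{f_n}$ the range of some edge of $F_n$, $F_0$ is a singleton, and $E_{n+1}\circ F_{n+1}\cong F_n\circ S_{f_n,f_{n+1}}$ for all $n\ge0$. *)

(* Defs.v *)
From HB Require Import structures.
From mathcomp Require Import all_boot all_classical.
From mathcomp Require Import topology cantor.

Set Implicit Arguments.
Unset Strict Implicit.
Unset Printing Implicit Defensive.

Local Open Scope classical_set_scope.

Section dynamics.
Context {X Y : topologicalType}.

Definition homeomorphism (f : X -> Y) : Prop :=
  exists g : Y -> X, [/\ cancel f g, cancel g f, continuous f & continuous g].

Definition factor_map (phi : X -> X) (psi : Y -> Y) (alpha : X -> Y) : Prop :=
  [/\ continuous alpha, set_surj [set: X] [set: Y] alpha
    & forall x, alpha (phi x) = psi (alpha x)].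

Definition conjugacy (phi : X -> X) (psi : Y -> Y) (alpha : X -> Y) : Prop :=
  factor_map phi psi alpha /\ homeomorphism alpha.

End dynamics.

Definition minimal_homeo (X : topologicalType) (phi : X -> X) : Prop :=
  homeomorphism phi /\
  forall A : set X, closed A -> phi @` A = A -> A = set0 \/ A = [set: X].

Definition cantor_minimal_system (X : topologicalType) (phi : X -> X) : Prop :=
  (exists h : X -> cantor_space, homeomorphism h) /\ minimal_homeo phi.

(* The linear orders on the fibres rng^-1{w} are packed into a single partial  *)
(* order on the edges, two edges being comparable iff they have the same       *)
(* range.                                                                      *)
Record edge_set (S T : finType) := EdgeSet {
  edge :> finType;
  src : edge -> S;
  rng : edge -> T;
  ele : rel edge;
  ele_refl : reflexive ele;
  ele_anti : antisymmetric ele;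
  ele_trans : transitive ele;
  ele_comparable : forall e e', ele e e' || ele e' e = (rng e == rng e') }.

Arguments src {S T F} _ : rename.
Arguments rng {S T F} _ : rename.
Arguments ele {S T F} _ _ : rename.

Section edges.
Context {S T : finType} {F : edge_set S T}.

Definition elt (e e' : F) : bool := (e != e') && ele e e'.

Definition maximal_edge (e : F) : bool := [forall e', ~~ elt e e'].

Definition minimal_edge (e : F) : bool := [forall e', ~~ elt e' e].

Definition successor_edge (e e' : F) : bool :=
  elt e e' && [forall g, elt e g ==> ele e' g].

End edges.

Section id_edges.
Variable S : finType.

Fact id_edges_comparable (e e' : S) : (e == e') || (e' == e) = (e == e').
Proof. by rewrite (eq_sym e') orbb. Qed.

Fact id_edges_anti : antisymmetric (fun e e' : S => e == e').
Proof. by move=> e e' /andP[/eqP]. Qed.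

Fact id_edges_trans : transitive (fun e e' : S => e == e').
Proof. by move=> e2 e1 e3 /eqP -> /eqP ->. Qed.

Definition id_edges : edge_set S S :=
  @EdgeSet S S S id id _ (@eqxx S) id_edges_anti id_edges_trans
    id_edges_comparable.

End id_edges.

Section comp_edges.
Context {S T U : finType}.
Variables (F : edge_set S T) (G : edge_set T U).

Definition comp_edge : finType := {p : F * G | rng p.1 == src p.2}.

Definition comp_le (p q : comp_edge) : bool :=
  elt (val p).2 (val q).2 ||
  ((val p).2 == (val q).2) && ele (val p).1 (val q).1.

Fact comp_le_refl : reflexive comp_le.
Proof. by move=> p; rewrite /comp_le eqxx ele_refl orbT. Qed.

Fact comp_le_anti : antisymmetric comp_le.
Proof.
move=> p q; rewrite /comp_le /elt => H; apply: val_inj; move: H.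
case: p q => [[a b] /= _] [[c d] /= _].
rewrite (eq_sym d); have [-> /= /ele_anti -> //|/= ne] := eqVneq b d.
by rewrite !orbF => /ele_anti E; rewrite E eqxx in ne.
Qed.

Fact comp_le_trans : transitive comp_le.
Proof.
move=> q p r; rewrite /comp_le /elt.
case: p q r => [[a b] /= _] [[c d] /= _] [[e f] /= _].
have [<-|bd] := eqVneq b d => /=.
  by have [_ /=|] := eqVneq b f; [exact: ele_trans | rewrite !orbF].
rewrite orbF => le_bd; have [<-|df] := eqVneq d f => /=; first by rewrite bd le_bd.
rewrite orbF => le_df; rewrite (ele_trans le_bd le_df) andbT orbC -implyNb.
apply/implyP => _; apply/eqP => bf; move/eqP: bd; apply.
by apply: ele_anti; rewrite le_bd {1}bf le_df.
Qed.

Fact comp_le_comparable p q :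
  comp_le p q || comp_le q p = (rng (val p).2 == rng (val q).2).
Proof.
rewrite /comp_le /elt.
case: p q => [[a b] /= /eqP ab] [[c d] /= /eqP cd]; rewrite (eq_sym d).
have [E|_ /=] := eqVneq b d; last by rewrite !orbF ele_comparable.
by rewrite /= ele_comparable ab cd E !eqxx.
Qed.

Definition comp_edges : edge_set S U :=
  @EdgeSet S U comp_edge (fun p => src (val p).1) (fun p => rng (val p).2)
    comp_le comp_le_refl comp_le_anti comp_le_trans comp_le_comparable.

End comp_edges.

Definition edge_iso (S T : finType) (F F' : edge_set S T) : Prop :=
  exists h : F -> F', [/\ bijective h, forall e, src (h e) = src e,
    forall e, rng (h e) = rng e & forall e e', ele (h e) (h e') = ele e e'].

(* Since the V_n are pairwise disjoint, a partial order on E for which edges   *)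
(* are comparable iff they have the same range amounts to one such order on    *)
(* each E_n. Edge levels are shifted by one: [edges n] is E_{n+1}.             *)
Record bratteli := Bratteli {
  vert : nat -> finType;
  edges : forall n, edge_set (vert n) (vert n.+1);
  vert_neq0 : forall n, (0 < #|vert n|)%N;
  vert0 : #|vert 0| = 1%N;
  edges_neq0 : forall n, (0 < #|edges n|)%N;
  src_surj : forall n (v : vert n), exists e : edges n, src e = v;
  rng_surj : forall n (v : vert n.+1), exists e : edges n, rng e = v }.

Arguments edges : clear implicits.

(* The unit factor [id_edges] at the start of the composition only matters up  *)
(* to [edge_iso], except for d = 0, where it is the convention for E_{k,k}.    *)
Fixpoint edges_add (B : bratteli) (k d : nat) : edge_set (vert B k) (vert B (d + k)) :=
  match d with
  | 0 => id_edges (vert B k)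
  | d'.+1 => comp_edges (edges_add B k d') (edges B (d' + k))
  end.

(* E_{k,l}, that is [edges_add B k (l - k)] with the type of its targets cast  *)
(* along l - k + k = l                                                         *)
Definition edges_btw (B : bratteli) (k l : nat) (kl : (k <= l)%N) :
    edge_set (vert B k) (vert B l) :=
  eq_rect (l - k + k)%N (fun m => edge_set (vert B k) (vert B m))
    (edges_add B k (l - k)) l (subnK kl).

Record ipath (B : bratteli) := IPath {
  iedge :> forall n, edges B n;
  iedge_path : forall n, rng (iedge n) = src (iedge n.+1) }.

HB.instance Definition _ (B : bratteli) := gen_eqMixin (ipath B).
HB.instance Definition _ (B : bratteli) := gen_choiceMixin (ipath B).

Section path_space.
Variable B : bratteli.

(* As every vertex emits an edge, every finite path from V_0 is an initial     *)
(* segment of some infinite path, so these are all the cylinder sets.          *)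
Definition cylinder (x : ipath B) (n : nat) : set (ipath B) :=
  [set y | forall i, (i < n)%N -> y i = x i].

Definition cylinders : set_system (ipath B) :=
  [set A | exists x n, A = cylinder x n].

Fact cylinders_cover : \bigcup_(A in cylinders) A = [set: ipath B].
Proof.
by apply/seteqP; split=> // x _; exists (cylinder x 0) => //; exists x, 0%N.
Qed.

Fact cylinders_join (A A' : set (ipath B)) (x : ipath B) :
  cylinders A -> cylinders A' -> A x -> A' x ->
  exists C, [/\ cylinders C, C x & C `<=` A `&` A'].
Proof.
move=> [y [n ->]] [y' [n' ->]] yx y'x; exists (cylinder x (maxn n n')).
split=> [||z zx]; [by exists x, (maxn n n') | by [] |].
by split=> i lt_i; rewrite zx ?leq_max ?lt_i ?orbT //; [exact: yx|exact: y'x].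
Qed.

HB.instance Definition _ :=
  isBaseTopological.Build (ipath B) (b := id) cylinders_cover cylinders_join.

Definition max_path (x : ipath B) : Prop := forall n, maximal_edge (x n).

Definition min_path (x : ipath B) : Prop := forall n, minimal_edge (x n).

Definition properly_ordered : Prop :=
  (exists! x, max_path x) /\ (exists! x, min_path x).

Definition vershik_rel (x y : ipath B) : Prop :=
  (max_path x /\ min_path y) \/
  exists k : nat,
    [/\ forall i, (i < k)%N -> maximal_edge (x i), ~~ maximal_edge (x k),
        successor_edge (x k) (y k), forall i, (i < k)%N -> minimal_edge (y i)
      & forall i, (k < i)%N -> y i = x i].

(* For properly ordered B the relation is the graph of a function, see vershikP *)
(* and vershik_rel_uniq below; the default value x is then never used.         *)
Definition vershik (x : ipath B) : ipath B := xget x (vershik_rel x).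

End path_space.

Lemma successor_edge_ex (S T : finType) (F : edge_set S T) (e : F) :
  ~~ maximal_edge e -> exists e', successor_edge e e'.
Proof.
move=> /forallPn[e0]; rewrite negbK => lt0.
pose m (g : F) := #|[pred g' | ele g' g]|.
case: (@arg_minnP _ e0 (elt e) m lt0) => e' lt1 minm; exists e'.
rewrite /successor_edge lt1; apply/forallP => g; apply/implyP => ltg.
have cmp : ele e' g || ele g e'.
  have rr (a : F) : elt e a -> rng e = rng a.
    by move=> /andP[_ le]; apply/eqP; rewrite -ele_comparable le.
  by rewrite ele_comparable -(rr _ lt1) -(rr _ ltg).
have /orP[//|le1] := cmp; have le2 := minm _ ltg.
have sub : [pred g' | ele g' g] \subset [pred g' | ele g' e'].
  by apply/fintype.subsetP => a; rewrite !inE => /ele_trans; apply.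
move: le2; rewrite (geq_leqif (subset_leqif_card sub)) => /fintype.subsetP.
by move=> /(_ e'); rewrite !inE; apply; exact: ele_refl.
Qed.

Lemma minimal_edge_ex (B : bratteli) n (v : vert B n.+1) :
  exists e : edges B n, minimal_edge e /\ rng e = v.
Proof.
have [e0 /eqP re0] := rng_surj v.
pose m (g : edges B n) := #|[pred g' | ele g' g]|.
case: (@arg_minnP _ e0 (fun e => rng e == v) m re0) => e /eqP re minm; exists e.
split=> //; apply/forallP => g; apply/negP => /andP[ne le].
have rg : rng g == v by rewrite -re -ele_comparable le.
have le2 := minm _ rg.
have sub : [pred g' | ele g' g] \subset [pred g' | ele g' e].
  by apply/fintype.subsetP => a; rewrite !inE => /ele_trans; apply.
move: le2; rewrite (geq_leqif (subset_leqif_card sub)) => /fintype.subsetP.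
move=> /(_ e); rewrite !inE => /(_ (ele_refl e)) le3.
by move/eqP: ne; apply; apply: ele_anti; rewrite le.
Qed.

Lemma path_modify_ex (B : bratteli) k :
  forall (x : forall n, edges B n) (f : edges B k),
  exists y : forall n, edges B n,
    [/\ y k = f, forall i, (k < i)%N -> y i = x i
      & forall i, (i < k)%N -> minimal_edge (y i) /\ rng (y i) = src (y i.+1)].
Proof.
elim: k => [|k IH] x f.
  exists (eqtype.dfwith x f); split=> //; first by rewrite dfwith_in.
  by move=> i i0; rewrite dfwith_out // eq_sym -lt0n.
have [e [mine re]] := minimal_edge_ex (src f).
have [y [yk ygt ylt]] := IH (eqtype.dfwith x f) e.
have ykS : y k.+1 = f by rewrite ygt // dfwith_in.
exists y; split=> // i.
  by move=> lti; rewrite ygt 1?ltnW // dfwith_out // ltn_eqF.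
rewrite ltnS leq_eqVlt => /predU1P[->|/ylt//].
by rewrite yk ykS.
Qed.

Lemma vershik_rel_ex (B : bratteli) (x : ipath B) :
  properly_ordered B -> exists y, vershik_rel x y.
Proof.
move=> [_ [xmin [minx _]]].
have [mx|/existsNP[n0 nmax]] := pselect (max_path x).
  by exists xmin; left.
have exn : exists n, ~~ maximal_edge (x n) by exists n0; exact/negP.
case: (ex_minnP exn) => k nmaxk mink.
have [f fP] := successor_edge_ex nmaxk.
have [y [yk ygt ylt]] := path_modify_ex x f.
have yP n : rng (y n) = src (y n.+1).
  have [/ylt[]//|gt|E] := ltngtP n k.
    by rewrite !ygt ?iedge_path // ltnW.
  rewrite E yk ygt // -iedge_path.
  by move: fP => /andP[/andP[_ le] _]; apply/eqP; rewrite eq_sym -ele_comparable le.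
exists (IPath yP); right; exists k; split=> //=; first 1 last.
- by rewrite yk.
- by move=> i /ylt[].
move=> i lti; apply/negPn/negP => /mink.
by rewrite leqNgt lti.
Qed.

Lemma vershikP (B : bratteli) (x : ipath B) :
  properly_ordered B -> vershik_rel x (vershik x).
Proof. by move=> Bp; apply: xgetPex; exact: vershik_rel_ex. Qed.

Lemma ipath_ext (B : bratteli) (x y : ipath B) : (forall n, x n = y n) -> x = y.
Proof.
case: x y => [x xP] [y yP] /= E.
have {}E : x = y by exact: functional_extensionality_dep.
by subst y; congr IPath; exact: Prop_irrelevance.
Qed.

Lemma minimal_edge_inj (S T : finType) (F : edge_set S T) (e e' : F) :
  minimal_edge e -> minimal_edge e' -> rng e = rng e' -> e = e'.
Proof.
move=> /forallP/(_ e') + /forallP/(_ e); rewrite /elt (eq_sym e').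
have [//|/= _ /negbTE h1 /negbTE h2 rr] := eqVneq e e'.
by have := ele_comparable e e'; rewrite h1 h2 rr eqxx.
Qed.

Lemma vershik_rel_uniq (B : bratteli) (x y z : ipath B) :
  properly_ordered B -> vershik_rel x y -> vershik_rel x z -> y = z.
Proof.
move=> [_ [xmin [_ umin]]] [[mx my]|[k [xlt xk sy ylt ygt]]].
  case=> [[_ mz]|[k [_ /negP nk _ _ _]]]; last by case: nk; exact: mx.
  by rewrite -(umin _ my) -(umin _ mz).
case=> [[mx _]|[k' [xlt' xk' sz zlt zgt]]]; first by rewrite mx in xk.
have E : k' = k.
  have [/xlt|/xlt'|//] := ltngtP k' k; first by rewrite (negbTE xk').
  by rewrite (negbTE xk).
subst k'; have yzk : y k = z k.
  case/andP: sy => ly /forallP hy; case/andP: sz => lz /forallP hz.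
  apply: ele_anti; have /implyP -> := hy (z k) => //.
  by have /implyP -> := hz (y k).
have yzlt d : (d <= k)%N -> y (k - d)%N = z (k - d)%N.
  elim: d => [|d IH] ltd; first by rewrite subn0.
  have lt : (k - d.+1 < k)%N by rewrite ltn_subrL /= (leq_trans _ ltd).
  apply: minimal_edge_inj; [exact: ylt|exact: zlt|].
  by rewrite !iedge_path subnSK // IH // ltnW.
apply: ipath_ext => n; have [lt|gt|->//] := ltngtP n k.
  by rewrite -(subKn (ltnW lt)) yzlt // leq_subr.
by rewrite ygt // zgt.
Qed.

Definition bv_model (B : bratteli) (X : topologicalType) (phi : X -> X) : Prop :=
  properly_ordered B /\
  exists alpha : ipath B -> X, conjugacy (@vershik B) phi alpha.

Record premorphism (B C : bratteli) := Premorphism {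
  lev : nat -> nat;
  lev0 : lev 0 = 0%N;
  lev_homo : forall n, (lev n <= lev n.+1)%N;
  lev_unbounded : forall N, exists n, (N <= lev n)%N;
  pedges : forall n, edge_set (vert B n) (vert C (lev n));
  pedges_neq0 : forall n, (0 < #|pedges n|)%N;
  pedges_src : forall n (v : vert B n), exists e : pedges n, src e = v;
  pedges_rng : forall n (w : vert C (lev n)), exists e : pedges n, rng e = w;
  pedges0 : #|pedges 0| = 1%N;
  pedges_comm : forall n,
    edge_iso (comp_edges (edges B n) (pedges n.+1))
             (comp_edges (pedges n) (edges_btw C (lev_homo n))) }.

(* Main.v *)
Require Import Defs.
From mathcomp Require Import all_boot all_classical.
From mathcomp Require Import topology cantor.
From mathcomp Require Import zify.

Set Implicit Arguments.
Unset Strict Implicit.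
Unset Printing Implicit Defensive.

Local Open Scope classical_set_scope.

(** From a premorphism to a factor map. A premorphism turns a path of [C] into
    a path of [B] by a letter-by-letter transduction. The internal state at
    stage n is an edge of F_n ending at the vertex through which the path of C
    passes at level f_n; the isomorphism between F_n o S_{f_n,f_{n+1}} and
    E_{n+1} o F_{n+1} turns this state and the next segment of the input path
    into the next output edge and the next state. Each output edge depends on
    finitely many input edges, so the map is continuous. It intertwines the
    Vershik maps because the isomorphisms preserve order: the successor of a
    pair in a composite is either a change of the first entry alone or a carry,
    and following this dichotomy along two consecutive input paths shows that
    the outputs are consecutive too ([image_path_vershik]). Surjectivity is then
    free, the image being closed and invariant ([minimal_factor]).

    From a factor map to a premorphism. A Kakutani-Rokhlin partition of a system
    is recorded as a locally constant map to the floors of finitely many finite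
    towers ([coding]). When one partition refines another and has the smaller
    base, each tower of the fine one is a concatenation of towers of the coarse
    one, and the occurrences of coarse towers in fine towers form an ordered edge
    set ([tower_edges]). Concatenation being transitive, the edge set of a
    composite refinement is the composite of the edge sets ([tower_comp_iso]).
    A refining sequence of partitions that separates points and whose bases
    shrink to one point therefore gives a Bratteli-Vershik model
    ([tower_diagram_model]). Such sequences are built from first return times to
    small clopen sets, and the sequence upstairs can be chosen so that its n-th
    partition refines the preimage of the n-th partition downstairs
    ([coding_sequence]). The edge sets of these last refinements are the F_n of
    a premorphism with f_n = n: both sides of the required isomorphism are the
    edge set of one and the same composite refinement ([tower_premorphism]). *)

(** * Orders on edge sets *)

Section edge_order.
Context {S T : finType} {F : edge_set S T}.
Implicit Types e f g : F.

Lemma ele_rng e f : ele e f -> rng e = rng f.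
Proof. by move=> le; apply/eqP; rewrite -ele_comparable le. Qed.

Lemma elt_rng e f : elt e f -> rng e = rng f.
Proof. by move=> /andP[_ /ele_rng]. Qed.

Lemma elt_nle e f : elt e f -> ~~ ele f e.
Proof.
by move=> /andP[ne le]; apply: contra ne => le'; apply/eqP/ele_anti/andP.
Qed.

Lemma nle_elt e f : rng e = rng f -> ~~ ele f e -> elt e f.
Proof.
move=> rr nle; have := ele_comparable e f.
rewrite rr eqxx (negbTE nle) orbF /elt => ->; rewrite andbT.
by apply: contra nle => /eqP ->; exact: ele_refl.
Qed.

Lemma maximal_edgeP e : maximal_edge e <-> forall f, rng f = rng e -> ele f e.
Proof.
split=> [/forallP mx f rr|mx]; last first.
  apply/forallP => f; apply/negP => lt.
  by have := elt_nle lt; rewrite mx // -(elt_rng lt).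
by apply/negPn/negP => /nle_elt; rewrite rr => /(_ erefl); exact/negP/mx.
Qed.

Lemma minimal_edgeP e : minimal_edge e <-> forall f, rng f = rng e -> ele e f.
Proof.
split=> [/forallP mn f rr|mn]; last first.
  apply/forallP => f; apply/negP => lt.
  by have := elt_nle lt; rewrite mn // -(elt_rng lt).
by apply/negPn/negP => /nle_elt; rewrite rr => /(_ erefl); exact/negP/mn.
Qed.

Lemma successor_edgeP e f : successor_edge e f <->
  elt e f /\ forall g, elt e g -> ele f g.
Proof.
split=> [/andP[lt /forallP h]|[lt h]].
  by split=> // g ltg; have /implyP := h g; apply.
by rewrite /successor_edge lt; apply/forallP => g; apply/implyP; exact: h.
Qed.

Lemma successor_nmax e f : successor_edge e f -> ~~ maximal_edge e.
Proof.
by move=> /andP[lt _]; apply/negP => /forallP/(_ f); rewrite lt.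
Qed.

End edge_order.

Section comp_order.
Context {S T U : finType} {F : edge_set S T} {G : edge_set T U}.
Implicit Types p q : comp_edges F G.

Lemma comp_edge_rng p : rng (val p).1 = src (val p).2.
Proof. by apply/eqP; exact: (valP p). Qed.

Lemma comp_edge_ex (e : F) (g : G) : rng e = src g ->
  exists p : comp_edges F G, val p = (e, g).
Proof. by move=> /eqP H; exists (Sub (e, g) H : {p : F * G | rng p.1 == src p.2}). Qed.

Lemma comp_eleE p q :
  ele p q = elt (val p).2 (val q).2 ||
            ((val p).2 == (val q).2) && ele (val p).1 (val q).1.
Proof. by []. Qed.

Lemma comp_ele2 p q : ele p q -> ele (val p).2 (val q).2.
Proof.
by rewrite comp_eleE => /orP[/andP[]//|/andP[/eqP-> _]]; exact: ele_refl.
Qed.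

Lemma comp_ele1 p q : ele p q -> (val p).2 = (val q).2 -> ele (val p).1 (val q).1.
Proof. by move=> /[swap] E; rewrite comp_eleE /elt E eqxx. Qed.

Lemma comp_elt2 p q : elt (val p).2 (val q).2 -> elt p q.
Proof.
move=> lt; rewrite /elt comp_eleE lt andbT.
by apply: contraTneq lt => ->; rewrite /elt eqxx.
Qed.

Lemma comp_elt1 p q :
  (val p).2 = (val q).2 -> elt (val p).1 (val q).1 -> elt p q.
Proof.
move=> E /andP[ne le]; rewrite /elt comp_eleE E eqxx le orbT andbT.
by apply: contra ne => /eqP ->.
Qed.

Lemma comp_eltP p q : elt p q ->
  elt (val p).2 (val q).2 \/
  (val p).2 = (val q).2 /\ elt (val p).1 (val q).1.
Proof.
move=> /andP[ne]; rewrite comp_eleE => /orP[->|/andP[/eqP E le]]; [by left|right].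
split=> //; rewrite /elt le andbT; apply: contra ne => /eqP E1.
by apply/eqP/val_inj; move: E E1; case: (val p) (val q) => [a b] [c d] /= -> ->.
Qed.

Lemma comp_maximal p :
  maximal_edge (val p).1 -> maximal_edge (val p).2 -> maximal_edge p.
Proof.
move=> /forallP m1 /forallP m2; apply/forallP => q; apply/negP => /comp_eltP.
by case=> [|[_]]; apply/negP.
Qed.

Lemma comp_minimal p :
  minimal_edge (val p).1 -> minimal_edge (val p).2 -> minimal_edge p.
Proof.
move=> /forallP m1 /forallP m2; apply/forallP => q; apply/negP => /comp_eltP.
by case=> [|[_]]; apply/negP.
Qed.

Lemma comp_successor1 p q : (val p).2 = (val q).2 ->
  successor_edge (val p).1 (val q).1 -> successor_edge p q.
Proof.
move=> E /successor_edgeP[lt sc]; apply/successor_edgeP.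
split=> [|r /comp_eltP]; first exact: comp_elt1.
rewrite comp_eleE -E => -[->//|[<- ltr]].
by rewrite eqxx sc // orbT.
Qed.

Lemma comp_successor2 p q : maximal_edge (val p).1 -> minimal_edge (val q).1 ->
  successor_edge (val p).2 (val q).2 -> successor_edge p q.
Proof.
move=> /forallP mx /minimal_edgeP mn /successor_edgeP[lt sc]; apply/successor_edgeP.
split=> [|r /comp_eltP[ltr|[_ ltr]]]; first exact: comp_elt2.
  rewrite comp_eleE /elt sc // andbT.
  have [E|//] := eqVneq (val q).2 (val r).2.
  by rewrite mn // !comp_edge_rng E.
by have := mx (val r).1; rewrite ltr.
Qed.

(* Every edge of G extends to an edge of the composite, so that G is seen in    *)
(* full by the order of the composite.                                         *)
Hypothesis rngF : forall v : T, exists e : F, rng e = v.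

Lemma comp_maximalE p :
  maximal_edge p -> maximal_edge (val p).1 /\ maximal_edge (val p).2.
Proof.
move=> /forallP mx; split; apply/forallP => g; apply/negP => lt.
  have [|q qE] := @comp_edge_ex g (val p).2.
    by rewrite -(elt_rng lt) comp_edge_rng.
  by have := mx q; rewrite comp_elt1 // qE.
have [e re] := rngF (src g); have [q qE] := comp_edge_ex re.
by have := mx q; rewrite comp_elt2 // qE.
Qed.

Lemma comp_minimalE p :
  minimal_edge p -> minimal_edge (val p).1 /\ minimal_edge (val p).2.
Proof.
move=> /forallP mx; split; apply/forallP => g; apply/negP => lt.
  have [|q qE] := @comp_edge_ex g (val p).2.
    by rewrite (elt_rng lt) comp_edge_rng.
  by have := mx q; rewrite comp_elt1 // qE.
have [e re] := rngF (src g); have [q qE] := comp_edge_ex re.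
by have := mx q; rewrite comp_elt2 // qE.
Qed.

(** In the lexicographic order a successor either moves the first coordinate
    alone, or it is a carry. *)
Lemma comp_successorP p q : successor_edge p q ->
  (val p).2 = (val q).2 /\ successor_edge (val p).1 (val q).1 \/
  [/\ maximal_edge (val p).1, minimal_edge (val q).1
    & successor_edge (val p).2 (val q).2].
Proof.
move=> /successor_edgeP[/comp_eltP lt sc].
case: lt => [lt|[E lt]]; [right|left].
  split.
  - apply/forallP => e; apply/negP => lte.
    have [|r rE] := @comp_edge_ex e (val p).2.
      by rewrite -(elt_rng lte) comp_edge_rng.
    have /sc/comp_ele2 : elt p r by rewrite comp_elt1 // rE.
    by rewrite rE /=; exact/negP/elt_nle.
  - apply/forallP => e; apply/negP => lte.
    have [|r rE] := @comp_edge_ex e (val q).2.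
      by rewrite (elt_rng lte) comp_edge_rng.
    have /sc/comp_ele1 : elt p r by rewrite comp_elt2 // rE.
    by rewrite rE /= => /(_ erefl); exact/negP/elt_nle.
  - apply/successor_edgeP; split=> // g ltg.
    have [e re] := rngF (src g); have [r rE] := comp_edge_ex re.
    have /sc/comp_ele2 : elt p r by rewrite comp_elt2 // rE.
    by rewrite rE.
split=> //; apply/successor_edgeP; split=> // e lte.
have [|r rE] := @comp_edge_ex e (val p).2.
  by rewrite -(elt_rng lte) comp_edge_rng.
have /sc/comp_ele1 : elt p r by rewrite comp_elt1 // rE.
by rewrite rE; apply.
Qed.

End comp_order.

Section edge_isos.
Context {S T : finType}.
Implicit Types F G H : edge_set S T.

Lemma edge_iso_sym F G : edge_iso F G -> edge_iso G F.
Proof.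
move=> [h [[k hK kK] hs hr ho]]; exists k; split=> [|e|e|e e'].
- by exists h.
- by rewrite -hs kK.
- by rewrite -hr kK.
- by rewrite -ho !kK.
Qed.

Lemma edge_iso_trans F G H : edge_iso F G -> edge_iso G H -> edge_iso F H.
Proof.
move=> [h [bh hs hr ho]] [k [bk ks kr ko]]; exists (k \o h); split=> [|e|e|e e'] /=.
- exact: bij_comp.
- by rewrite ks hs.
- by rewrite kr hr.
- by rewrite ko ho.
Qed.

Section transport.
Context {F G : edge_set S T}.
Variable h : F -> G.
Hypotheses (bh : bijective h) (ho : forall e e', ele (h e) (h e') = ele e e').

Lemma iso_elt e e' : elt (h e) (h e') = elt e e'.
Proof. by rewrite /elt ho (inj_eq (bij_inj bh)). Qed.

Lemma iso_maximal e : maximal_edge e -> maximal_edge (h e).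
Proof.
have [k hK kK] := bh; move=> /forallP mx; apply/forallP => f.
by rewrite -[f]kK iso_elt.
Qed.

Lemma iso_minimal e : minimal_edge e -> minimal_edge (h e).
Proof.
have [k hK kK] := bh; move=> /forallP mx; apply/forallP => f.
by rewrite -[f]kK iso_elt.
Qed.

Lemma iso_successor e e' : successor_edge e e' -> successor_edge (h e) (h e').
Proof.
have [k hK kK] := bh; move=> /successor_edgeP[lt sc]; apply/successor_edgeP.
by rewrite iso_elt; split=> // f; rewrite -[f]kK iso_elt ho; exact: sc.
Qed.

End transport.
End edge_isos.

Lemma comp_edge_iso (S T U : finType) (F : edge_set S T) (G G' : edge_set T U) :
  edge_iso G G' -> edge_iso (comp_edges F G) (comp_edges F G').
Proof.
move=> [h [bh hs hr ho]]; have [k hK kK] := bh.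
have hP (p : comp_edges F G) : rng (val p).1 == src (h (val p).2).
  by rewrite hs comp_edge_rng.
have kP (p : comp_edges F G') : rng (val p).1 == src (k (val p).2).
  by rewrite -hs kK comp_edge_rng.
exists (fun p => Sub (_, _) (hP p) : comp_edges F G'); split=> [|p|p|p q] //=.
- exists (fun p => Sub (_, _) (kP p) : comp_edges F G) => p; apply: val_inj => /=.
    by rewrite hK -surjective_pairing.
  by rewrite kK -surjective_pairing.
- by rewrite /comp_le /= (iso_elt bh ho) (inj_eq (bij_inj bh)).
Qed.

Lemma comp_id_edge_iso (S T : finType) (F : edge_set S T) :
  edge_iso F (comp_edges (id_edges S) F).
Proof.
have hP (e : F) : rng (src e : id_edges S) == src e by [].
exists (fun e => Sub (_, _) (hP e) : comp_edges (id_edges S) F).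
split=> [|e|e|e e'] //=.
  exists (fun p => (val p).2) => [e|p] //=; apply: val_inj => /=.
  by have /eqP <- := valP p; rewrite -surjective_pairing.
rewrite /comp_le /elt /=; have [->|_] := eqVneq e e'; last by rewrite orbF.
by rewrite !eqxx ele_refl.
Qed.

(** * Segments of infinite paths *)

(** The target of [edges_btw] is only known up to a cast, so segments of paths
    are handled through the properties below. The bound in [seg_eq] includes l
    because for k = l the segment is a vertex, which is read off the edge that
    leaves it. *)
Record segment (C : bratteli) (k l : nat) (F : edge_set (vert C k) (vert C l))
    (seg : ipath C -> F) : Prop := Segment {
  seg_src : forall x, src (seg x) = src (x k);
  seg_rng : forall x, rng (seg x) = src (x l);
  seg_maximal : forall x : ipath C,
    (forall i, (i < l)%N -> maximal_edge (x i)) -> maximal_edge (seg x);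
  seg_minimal : forall x : ipath C,
    (forall i, (i < l)%N -> minimal_edge (x i)) -> minimal_edge (seg x);
  seg_eq : forall x y : ipath C, (forall i, (k <= i <= l)%N -> y i = x i) -> seg y = seg x;
  seg_successor : forall (x y : ipath C) m, (k <= m < l)%N ->
    (forall i, (i < m)%N -> maximal_edge (x i)) -> successor_edge (x m) (y m) ->
    (forall i, (i < m)%N -> minimal_edge (y i)) ->
    (forall i, (m < i)%N -> y i = x i) -> successor_edge (seg x) (seg y) }.

Lemma edges_add_segment (C : bratteli) k d :
  exists seg : ipath C -> edges_add C k d, segment seg.
Proof.
elim: d => [|d [seg [ss sr smx smn seq ssc]]].
  exists (fun x => src (x k)); split=> //.
  - by move=> x _; apply/maximal_edgeP => f /eqP.
  - by move=> x _; apply/minimal_edgeP => f /esym/eqP.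
  - by move=> x y E; rewrite E // leqnn.
  - by move=> x y m km; exfalso; lia.
have P x : rng (seg x) == src (x (d + k)%N) by rewrite sr.
exists (fun x => Sub (seg x, x (d + k)%N) (P x) : comp_edges _ _).
split=> [x|x|x mx|x mn|x y E|x y m /andP[km ml] mx sc mn E] /=.
- exact: ss.
- exact: iedge_path.
- by apply: comp_maximal => /=; [apply: smx => i ltid; apply: mx; lia|apply: mx; lia].
- by apply: comp_minimal => /=; [apply: smn => i ltid; apply: mn; lia|apply: mn; lia].
- apply: val_inj => /=; congr pair; last by apply: E; lia.
  by apply: seq => i ikl; apply: E; lia.
- have [lt|ge] := ltnP m (d + k).
    apply: comp_successor1 => /=; first by rewrite E.
    by apply: (ssc _ _ m) => //; lia.
  have Em : m = (d + k)%N by lia.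
  subst m; apply: comp_successor2 => //=.
    by apply: smx => i ltid; apply: mx; lia.
  by apply: smn => i ltid; apply: mn; lia.
Qed.

Lemma edges_btw_segment (C : bratteli) k l (kl : (k <= l)%N) :
  exists seg : ipath C -> edges_btw C kl, segment seg.
Proof.
rewrite /edges_btw; move: (l - k)%N (subnK kl) => d e.
by case: l / e kl => _; exact: edges_add_segment.
Qed.

(** * The factor map of a premorphism *)

Section transducer.
Context {B C : bratteli}.
Variable f : premorphism B C.
Implicit Types x y : ipath C.

Lemma lev_mono i j : (i <= j)%N -> (lev f i <= lev f j)%N.
Proof. by move: i j; apply: homo_leq leqnn leq_trans _; exact: lev_homo. Qed.

(** The transducer reads the input path in blocks, the n-th one running from
    level f_n to level f_{n+1}. *)
Definition block n : ipath C -> edges_btw C (lev_homo f n) :=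
  sval (cid (edges_btw_segment C (lev_homo f n))).

Lemma blockP n : segment (block n).
Proof. exact: svalP (cid _). Qed.

Definition swap n :
    comp_edges (pedges f n) (edges_btw C (lev_homo f n)) ->
    comp_edges (edges B n) (pedges f n.+1) :=
  sval (cid (edge_iso_sym (pedges_comm f n))).

Arguments swap : clear implicits.

Lemma swapP n : [/\ bijective (swap n), forall e, src (swap n e) = src e,
  forall e, rng (swap n e) = rng e & forall e e', ele (swap n e) (swap n e') = ele e e'].
Proof. by rewrite /swap; case: cid. Qed.

(** The range condition is what makes the state composable with the next block
    of the input. *)
Definition state (x : ipath C) n := {p : pedges f n | rng p == src (x (lev f n))}.

Lemma state0_ex x : exists p : pedges f 0, rng p == src (x (lev f 0)).
Proof.
have [e _] := pedges_rng (src (x (lev f 0))); exists e.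
have : (#|vert C (lev f 0)| <= 1)%N by rewrite lev0 vert0.
by move=> /card_le1_eqP card1; apply/eqP/card1.
Qed.

Definition state0 x : state x 0 :=
  exist _ _ (svalP (cid (state0_ex x))).

Lemma input_subproof x n (p : state x n) : rng (val p) == src (block n x).
Proof. by rewrite (seg_src (blockP n)) (valP p). Qed.

Definition step x n (p : state x n) : comp_edges (edges B n) (pedges f n.+1) :=
  swap n (Sub (val p, block n x) (input_subproof p) :
    comp_edges (pedges f n) (edges_btw C (lev_homo f n))).

Lemma step_subproof x n (p : state x n) :
  rng (val (step p)).2 == src (x (lev f n.+1)).
Proof.
have [_ _ hr _] := swapP n.
by rewrite -(seg_rng (blockP n)); apply/eqP; exact: hr.
Qed.

Fixpoint run (x : ipath C) n : state x n :=
  match n with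
  | 0 => state0 x
  | n'.+1 => exist _ (val (step (run x n'))).2 (step_subproof (run x n'))
  end.

Definition out x n : edges B n := (val (step (run x n))).1.

Lemma out_path x n : rng (out x n) = src (out x n.+1).
Proof.
have [_ hs _ _] := swapP n.+1.
have /eqP -> := valP (step (run x n)).
by apply: esym; apply: hs.
Qed.

Definition image_path x : ipath B := IPath (out_path x).

Definition input x n : comp_edges (pedges f n) (edges_btw C (lev_homo f n)) :=
  Sub (val (run x n), block n x) (input_subproof (run x n)).

Definition output x n : comp_edges (edges B n) (pedges f n.+1) := swap n (input x n).

Lemma val_output x n : val (output x n) = (image_path x n, val (run x n.+1)).
Proof. by rewrite /= /out -surjective_pairing. Qed.

Lemma pedges0_eq (p q : pedges f 0) : p = q.
Proof. by have /card_le1_eqP := eq_leq (pedges0 f); apply. Qed.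

Lemma run_step_eq x y n : val (run x n) = val (run y n) ->
  (forall i, (lev f n <= i <= lev f n.+1)%N -> x i = y i) ->
  image_path x n = image_path y n /\ val (run x n.+1) = val (run y n.+1).
Proof.
move=> E Exy; have {E} : input x n = input y n.
  by apply: val_inj => /=; rewrite E (seg_eq (blockP n) Exy).
by move=> /(congr1 (swap n))/(congr1 val); rewrite !val_output => -[].
Qed.

(** Finite dependence of the output on the input; this is continuity. *)
Lemma image_path_eq x y n : (forall i, (i <= lev f n.+1)%N -> x i = y i) ->
  forall i, (i <= n)%N -> image_path x i = image_path y i.
Proof.
move=> E; have S i : (i <= n)%N -> val (run x i) = val (run y i) ->
    image_path x i = image_path y i /\ val (run x i.+1) = val (run y i.+1).
  move=> lein Ei; apply: run_step_eq => // j /andP[_ jl].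
  by apply: E; apply: leq_trans jl (lev_mono _).
have R i : (i <= n)%N -> val (run x i) = val (run y i).
  elim: i => [_|i IH lein]; first exact: pedges0_eq.
  by have [] := S i (ltnW lein) (IH (ltnW lein)).
by move=> i lein; have [] := S i lein (R i lein).
Qed.

(** Once two runs are in the same state and their inputs agree from there on,
    they never separate again. *)
Lemma run_tail_eq x y n : val (run x n) = val (run y n) ->
  (forall i, (lev f n <= i)%N -> x i = y i) ->
  forall i, (n <= i)%N -> image_path x i = image_path y i.
Proof.
move=> E Exy; have S i : (n <= i)%N -> val (run x i) = val (run y i) ->
    image_path x i = image_path y i /\ val (run x i.+1) = val (run y i.+1).
  move=> ni Ei; apply: run_step_eq => // j /andP[jl _].
  by apply: Exy; exact: leq_trans (lev_mono ni) jl.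
have R i : (n <= i)%N -> val (run x i) = val (run y i).
  elim: i => [|i IH]; first by rewrite leqn0 => /eqP <-.
  by rewrite leq_eqVlt => /predU1P[<-//|ni]; have [] := S i ni (IH ni).
by move=> i ni; have [] := S i ni (R i ni).
Qed.

(** A maximal composite edge has maximal components, so maximality of the state
    and of the output propagates from one stage to the next. *)
Lemma image_path_maximal x n : (forall i, (i < lev f n)%N -> maximal_edge (x i)) ->
  maximal_edge (val (run x n)) /\ forall i, (i < n)%N -> maximal_edge (image_path x i).
Proof.
elim: n => [_|n IH mx].
  split=> //; apply/forallP => e; apply/negP => /andP[/eqP ne _].
  exact/ne/pedges0_eq.
have [|m1 m2] := IH; first by move=> i lti; apply: mx; apply: leq_trans lti (lev_homo f n).
have : maximal_edge (input x n).
  by apply: comp_maximal => //=; exact: (seg_maximal (blockP n)) mx.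
have [bh _ _ ho] := swapP n => /(iso_maximal bh ho)/comp_maximalE.
rewrite val_output => /(_ (@rng_surj B n))[/= m3 m4]; split=> // i.
by rewrite ltnS leq_eqVlt => /predU1P[->|/m2].
Qed.

Lemma image_path_minimal x n : (forall i, (i < lev f n)%N -> minimal_edge (x i)) ->
  minimal_edge (val (run x n)) /\ forall i, (i < n)%N -> minimal_edge (image_path x i).
Proof.
elim: n => [_|n IH mx].
  split=> //; apply/forallP => e; apply/negP => /andP[/eqP ne _].
  exact/ne/pedges0_eq.
have [|m1 m2] := IH; first by move=> i lti; apply: mx; apply: leq_trans lti (lev_homo f n).
have : minimal_edge (input x n).
  by apply: comp_minimal => //=; exact: (seg_minimal (blockP n)) mx.
have [bh _ _ ho] := swapP n => /(iso_minimal bh ho)/comp_minimalE.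
rewrite val_output => /(_ (@rng_surj B n))[/= m3 m4]; split=> // i.
by rewrite ltnS leq_eqVlt => /predU1P[->|/m2].
Qed.

(** From here on, x and y are consecutive input paths that differ by a carry at
    the level k. *)
Section carry.
Variables (x y : ipath C) (k : nat).
Hypotheses (mx : forall i, (i < k)%N -> maximal_edge (x i))
  (sc : successor_edge (x k) (y k))
  (mn : forall i, (i < k)%N -> minimal_edge (y i))
  (E : forall i, (k < i)%N -> y i = x i).

(** After the input carry, either the two states are consecutive and the output
    carry is still to come, or the output carry has taken place and the states
    have become equal. *)
Definition pending n :=
  [/\ successor_edge (val (run x n)) (val (run y n)),
      forall i, (i < n)%N -> maximal_edge (image_path x i)
    & forall i, (i < n)%N -> minimal_edge (image_path y i)].

Definition settled n := val (run x n) = val (run y n) /\ exists j, [/\ (j < n)%N,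
  forall i, (i < j)%N -> maximal_edge (image_path x i),
  successor_edge (image_path x j) (image_path y j),
  forall i, (i < j)%N -> minimal_edge (image_path y i)
  & forall i, (j < i < n)%N -> image_path y i = image_path x i].

(** Consecutive inputs of the isomorphism have consecutive outputs, and
    [comp_successorP] says what these look like: equal new states if the output
    edge moves, consecutive new states if it wraps around. *)
Lemma pending_step n : successor_edge (input x n) (input y n) ->
  (forall i, (i < n)%N -> maximal_edge (image_path x i)) ->
  (forall i, (i < n)%N -> minimal_edge (image_path y i)) ->
  pending n.+1 \/ settled n.+1.
Proof.
have [bh _ _ ho] := swapP n => /(iso_successor bh ho) + m1 m2.
move=> /(comp_successorP (@rng_surj B n)); rewrite !val_output /=.
case=> [[Er s]|[m3 m4 s]]; [right|left].
  by split=> //; exists n; split=> // i lti; exfalso; lia.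
by split=> // i; rewrite ltnS leq_eqVlt => /predU1P[->|]; auto.
Qed.

Lemma carry_invariant n : (k < lev f n)%N -> pending n \/ settled n.
Proof.
elim: n => [|n IH ltk]; first by rewrite lev0.
have [ltn|kge] := ltnP k (lev f n).
  have [[s m1 m2]|[Er [j [jn m1 s m2 e]]]] := IH ltn.
    apply: pending_step => //; apply: comp_successor1 => //=.
    by apply: (seg_eq (blockP n)) => i il; rewrite E //; lia.
  right; have [|e1 e2] := @run_step_eq x y n Er.
    by move=> i il; rewrite E //; lia.
  split=> //; exists j; split=> // [|i]; first exact: ltnW.
  rewrite ltnS => /andP[ji]; rewrite leq_eqVlt => /predU1P[->//|lti].
  by rewrite e // ji.
have [|rm m1] := @image_path_maximal x n; first by move=> i il; apply: mx; exact: leq_trans kge.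
have [|rn m2] := @image_path_minimal y n; first by move=> i il; apply: mn; exact: leq_trans kge.
apply: pending_step => //; apply: comp_successor2 => //=.
by apply: (seg_successor (blockP n) (m := k)); rewrite ?kge.
Qed.

(** If the runs settle, the output carry is a carry of infinite paths; if they
    stay pending forever, the outputs are the maximal and the minimal path. *)
Lemma carry_vershik : vershik_rel (image_path x) (image_path y).
Proof.
have [[n [ltk [Er [j [jn m1 s m2 e]]]]]|nset] :=
    pselect (exists n, (k < lev f n)%N /\ settled n).
  right; exists j; split=> //; first exact: successor_nmax s.
  move=> i ji; have [lti|gei] := ltnP i n; first by rewrite e // ji.
  by rewrite (run_tail_eq Er) // => l ll; rewrite E //; exact: leq_trans ll.
have [n0 n0P] := lev_unbounded f k.+1.
have pend i : exists2 n, (i < n)%N & pending n.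
  have ltk : (k < lev f (maxn n0 i.+1))%N by apply: leq_trans (lev_mono (leq_maxl _ _)).
  exists (maxn n0 i.+1); first exact: leq_maxr.
  by have [//|st] := carry_invariant ltk; case: nset; exists (maxn n0 i.+1).
by left; split=> i; have [n lt [_ m1 m2]] := pend i; auto.
Qed.

End carry.

Lemma image_path_vershik x y : vershik_rel x y -> vershik_rel (image_path x) (image_path y).
Proof.
case=> [[mx mn]|[k [mx _ sc mn E]]]; last exact: carry_vershik mx sc mn E.
left; split=> i.
  by have [//|_ ->] := @image_path_maximal x i.+1.
by have [//|_ ->] := @image_path_minimal y i.+1.
Qed.

End transducer.

(** * Cantor spaces *)

Definition locally_constant (X : topologicalType) (K : Type) (g : X -> K) :=
  forall x, \forall y \near x, g y = g x.

Section locally_constant.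
Context {X Y : topologicalType}.

Lemma locally_constant_comp (K : Type) (f : X -> Y) (g : Y -> K) :
  continuous f -> locally_constant g -> locally_constant (g \o f).
Proof. by move=> cf lg x; exact: cf (lg (f x)). Qed.

Lemma locally_constant_map (K L : Type) (F : K -> L) (g : X -> K) :
  locally_constant g -> locally_constant (F \o g).
Proof. by move=> lg x; apply: filterS (lg x) => y /= ->. Qed.

Lemma locally_constant_pair (K L : Type) (g : X -> K) (h : X -> L) :
  locally_constant g -> locally_constant h -> locally_constant (fun x => (g x, h x)).
Proof. by move=> lg lh x; apply: filterS2 (lg x) (lh x) => y -> ->. Qed.

Lemma locally_constant_ffun (I : finType) (K : Type) (g : I -> X -> K) :
  (forall i, locally_constant (g i)) ->
  locally_constant (fun x => [ffun i => g i x]).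
Proof.
move=> lg x; have : \forall y \near x, forall i, g i y = g i x.
  by apply: filter_forall => i; exact: lg.
by apply: filterS => y E; apply/ffunP => i; rewrite !ffunE.
Qed.

(** Compactness in the form used throughout: if every point has a neighbourhood
    that is contained in some member of an increasing sequence, then one member
    is the whole space. *)
Lemma compact_exhaust (P : nat -> set X) : compact [set: X] ->
  (forall m n x, (m <= n)%N -> P m x -> P n x) ->
  (forall x : X, exists n, nbhs x (P n)) -> exists n, forall x, P n x.
Proof.
move=> /compact_near_coveringP cX Pmono Ploc.
have : \forall n \near \oo, [set: X] `<=` P n.
  apply: (cX nat \oo (fun n x => P n x)) => x _; have [n nP] := Ploc x.
  exists (P n, [set m | (n <= m)%N]) => /=; first by split=> //; exists n.
  by move=> [y m] /= [Py nm]; exact: Pmono nm Py.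
by move=> [n _ nP]; exists n => x; exact: (nP n (leqnn n)).
Qed.

End locally_constant.

Definition cantor_like_space (X : topologicalType) : Prop :=
  exists h : X -> cantor_space, homeomorphism h.

Section cantor.
Variable X : topologicalType.
Hypothesis hX : cantor_like_space X.

Lemma cantor_nonempty : exists x : X, True.
Proof. by have [h [g _]] := hX; exists (g point). Qed.

Lemma cantor_compact : compact [set: X].
Proof.
have [h [g [hK gK ch cg]]] := hX.
have -> : [set: X] = g @` [set: cantor_space].
  by apply/seteqP; split=> // x _; exists (h x).
apply: continuous_compact; last exact: cantor_space_compact.
exact: continuous_subspaceT.
Qed.

Lemma cantor_separation : exists g : nat -> X -> bool,
  (forall n, locally_constant (g n)) /\ forall x y, (forall n, g n x = g n y) -> x = y.
Proof.
have [h [g [hK gK ch cg]]] := hX.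
exists (fun n x => h x n); split=> [n|x y E]; last first.
  by rewrite -[x]hK -[y]hK; congr g; apply: functional_extensionality_dep.
apply: (@locally_constant_comp X cantor_space _ h (fun z : cantor_space => z n)) => // z.
have : open ((fun z : cantor_space => z n) @^-1` [set z n]).
  apply: open_comp; last exact: discrete_open.
  by move=> y _; exact: (@proj_continuous nat (fun=> bool) n y).
by move=> o; apply: open_nbhs_nbhs; split.
Qed.

End cantor.

Lemma cylinder_nbhs (B : bratteli) (x : ipath B) n : nbhs x (cylinder x n).
Proof.
apply: open_nbhs_nbhs; split=> //.
exists [set cylinder x n]; last by rewrite bigcup_set1.
by move=> _ ->; exists x, n.
Qed.

Lemma nbhs_cylinder (B : bratteli) (x : ipath B) (U : set (ipath B)) :
  nbhs x U -> exists n, cylinder x n `<=` U.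
Proof.
rewrite nbhsE => -[V [[D sD <-] [A DA Ax]] sVU].
have [y [n AE]] := sD _ DA; exists n => z zx.
apply/sVU; exists A => //; move: Ax; rewrite AE => xy i lti /=.
by rewrite zx // xy.
Qed.

Section minimality.
Context {X Y : topologicalType}.
Variables (phi : X -> X) (psi : Y -> Y).
Hypotheses (hX : cantor_minimal_system phi) (hY : cantor_minimal_system psi).

(** The image is compact, hence closed, and psi-invariant, so that minimality of
    psi leaves it no choice but to be everything. *)
Lemma minimal_factor (alpha : X -> Y) : continuous alpha ->
  (forall x, alpha (phi x) = psi (alpha x)) -> factor_map phi psi alpha.
Proof.
move=> ca eq; split=> //.
have [cX [[phi' [phiK phi'K _ _]] _]] := hX; have [cY [_ mY]] := hY.
(* A point y outside the image is separated from all alpha x by one of finitely *)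
(* many clopen partitions.                                                     *)
have cl : closed (range alpha).
  move=> y cly; apply: contrapT => ny.
  have [g [glc gsep]] := cantor_separation cY.
  have [||n nP] := @compact_exhaust X
      (fun n x => exists2 i, (i < n)%N & g i (alpha x) != g i y) (cantor_compact cX).
  - by move=> m n x mn [i im gi]; exists i => //; exact: leq_trans mn.
  - move=> x; have [i gi] : exists i, g i (alpha x) != g i y.
      apply: contrapT => /forallNP ng; apply: ny; exists x => //; apply: gsep => i.
      by apply/eqP/negPn/negP/ng.
    exists i.+1; have := locally_constant_comp ca (glc i) x.
    by apply: filterS => z /= E; exists i; rewrite ?E.
  have : \forall z \near y, forall i : 'I_n, g i z = g i y.
    by apply: filter_forall => i; exact: glc.
  move=> /cly[z [[x _ <-] E]]; have [i lti] := nP x.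
  by rewrite (E (Ordinal lti)) eqxx.
have img : psi @` range alpha = range alpha.
  apply/seteqP; split=> [_ [_ [x _ <-] <-]|_ [x _ <-]].
    by exists (phi x); rewrite ?eq.
  by exists (alpha (phi' x)); [exists (phi' x)|rewrite -eq phi'K].
have [E|E] := mY _ cl img; last by move=> y _; have : range alpha y by rewrite E.
have [x _] := cantor_nonempty cX; suff : range alpha (alpha x) by rewrite E.
by exists x.
Qed.

Lemma premorphism_factor (C B : bratteli) : bv_model C phi -> bv_model B psi ->
  premorphism B C -> exists alpha : X -> Y, factor_map phi psi alpha.
Proof.
move=> [Cp [a [[ca _ ea] [a' [aK a'K _ ca']]]]] [Bp [b [[cb _ eb] _]]] f.
exists (fun x => b (image_path f (a' x))); apply: minimal_factor => x.
  move=> U /cb/nbhs_cylinder[n sU].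
  have /(ca' x) := cylinder_nbhs (a' x) (lev f n.+1).+1.
  apply: (@filterS X (nbhs x)) => z zE; apply: sU => i lti.
  by apply: image_path_eq (ltnW lti) => j jl; apply: zE.
rewrite -eb; congr b; apply: (vershik_rel_uniq Bp); last exact: vershikP.
have -> : a' (phi x) = vershik (a' x) by rewrite -[RHS]aK ea a'K.
exact/image_path_vershik/vershikP.
Qed.

End minimality.

(** * Tower shapes *)

(** The combinatorial part of a Kakutani-Rokhlin partition: finitely many towers
    with their heights. The atoms are the [floor]s of the towers. *)
Record tower_shape := TowerShape {
  tower : finType;
  height : tower -> nat;
  height_gt0 : forall t, (0 < height t)%N }.

Arguments height {t} _ : rename.

Definition floor (P : tower_shape) : finType := {t : tower P & 'I_(height t)}.

Section floors.
Context {P : tower_shape}.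
Implicit Types p q : floor P.

Definition tw p : tower P := tag p.

Definition idx p : nat := tagged p.

Definition bottom p := idx p == 0%N.

Definition top p := (idx p).+1 == height (tw p).

(** The moves that the dynamics can make between atoms: one floor up, or from a
    roof to the ground floor of an arbitrary tower. *)
Definition follows p q :=
  if top p then bottom q else (tw q == tw p) && (idx q == (idx p).+1).

Lemma idx_lt p : (idx p < height (tw p))%N.
Proof. exact: ltn_ord. Qed.

Lemma floor_eq p q : tw p = tw q -> idx p = idx q -> p = q.
Proof.
case: p q => [t i] [u j]; rewrite /tw /idx /= => E; subst u => /= ij.
by congr existT; exact: val_inj.
Qed.

Lemma floor_ex (t : tower P) i : (i < height t)%N -> exists p, tw p = t /\ idx p = i.
Proof. by move=> lti; exists (Tagged (fun t : tower P => 'I_(height t)) (Ordinal lti)). Qed.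

Lemma bottom_ex t : exists p, tw p = t /\ bottom p.
Proof. by have [p [pt /eqP pi]] := floor_ex (height_gt0 t); exists p. Qed.

End floors.

(** The map from the atoms of a partition to those of a coarser one with a larger
    base. The last two conditions say that each tower of [Q] is cut by [r] into
    blocks, each of which climbs one tower of [P] from bottom to top. *)
Definition tower_map (P Q : tower_shape) (r : floor Q -> floor P) : Prop :=
  [/\ forall p, exists q, r q = p, forall q, bottom q -> bottom (r q)
    & forall q q', follows q q' -> follows (r q) (r q')].

Section tower_edges.
Context {P Q : tower_shape}.
Variable r : floor Q -> floor P.

(** An occurrence of a tower of [P] in a tower of [Q] is identified with the floor
    at which it starts. *)
Definition tower_edge : finType := {q : floor Q | bottom (r q)}.

Definition tower_le (e e' : tower_edge) : bool :=
  (tw (val e) == tw (val e')) && (idx (val e) <= idx (val e'))%N.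

Fact tower_le_refl : reflexive tower_le.
Proof. by move=> e; rewrite /tower_le eqxx leqnn. Qed.

Fact tower_le_anti : antisymmetric tower_le.
Proof.
move=> e e' /andP[/andP[/eqP E l] /andP[_ l']]; apply/val_inj/floor_eq => //.
by apply/eqP; rewrite eqn_leq l.
Qed.

Fact tower_le_trans : transitive tower_le.
Proof.
move=> e2 e1 e3 /andP[/eqP E l] /andP[/eqP E' l'].
by rewrite /tower_le E E' eqxx (leq_trans l).
Qed.

Fact tower_le_comparable e e' :
  tower_le e e' || tower_le e' e = (tw (val e) == tw (val e')).
Proof. by rewrite /tower_le (eq_sym (tw (val e'))) -andb_orr leq_total andbT. Qed.

Definition tower_edges : edge_set (tower P) (tower Q) :=
  @EdgeSet _ _ tower_edge (fun e => tw (r (val e))) (fun e => tw (val e)) tower_le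
    tower_le_refl tower_le_anti tower_le_trans tower_le_comparable.

Definition edge_floor (e : tower_edges) : floor Q := val e.

Hypothesis hr : tower_map r.

Lemma bottom_edge_floor e : bottom (r (edge_floor e)).
Proof. exact: valP e. Qed.

Lemma edge_floor_ex q : bottom (r q) -> exists e, edge_floor e = q.
Proof. by move=> b; exists (Sub q b : tower_edge). Qed.

Lemma tower_eleE (e e' : tower_edges) :
  ele e e' = (rng e == rng e') && (idx (edge_floor e) <= idx (edge_floor e'))%N.
Proof. by []. Qed.

Lemma tower_eltE e e' : rng e = rng e' ->
  elt e e' = (idx (edge_floor e) < idx (edge_floor e'))%N.
Proof.
move=> E; apply/idP/idP => [lt|lt].
  by have := elt_nle lt; rewrite tower_eleE E eqxx ltnNge.
by apply: nle_elt => //; rewrite tower_eleE negb_and -ltnNge lt orbT.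
Qed.

(** After a roof of [Q] comes a ground floor, which lies over a ground floor of
    [P], and in [P] only roofs are followed by ground floors. *)
Lemma top_map q : top q -> top (r q).
Proof.
case: hr => _ rb rf tq; have [q' [_ bq']] := bottom_ex (tw q).
have := rf q q'; rewrite /follows tq => /(_ bq'); case: (top (r q)) => //.
by have := rb q' bq'; rewrite /bottom => /eqP ->; rewrite andbF.
Qed.

Lemma map_up q q' : tw q' = tw q -> idx q' = (idx q).+1 ->
  if top (r q) then bottom (r q') : Prop
  else tw (r q') = tw (r q) /\ idx (r q') = (idx (r q)).+1.
Proof.
move=> E1 E2; case: hr => _ _ /(_ q q'); rewrite /follows E1 E2 !eqxx /=.
have -> : top q = false.
  by apply/eqP => tq; have := idx_lt q'; rewrite E1 E2 tq ltnn.
by move=> /(_ erefl); case: ifP => // _ /andP[/eqP -> /eqP ->].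
Qed.

(** A block does not end before the top of the tower of [P] that it occupies: by
    [top_map] there is room in [Q] as long as there is room in [P]. *)
Lemma climb e i : (i < height (src e))%N -> exists q, [/\ tw q = rng e,
  idx q = (idx (edge_floor e) + i)%N, tw (r q) = src e & idx (r q) = i].
Proof.
elim: i => [_|i IH lti].
  exists (edge_floor e); split=> //; first by rewrite addn0.
  exact/eqP/bottom_edge_floor.
have [q [qt qi rqt rqi]] := IH (ltnW lti).
have ntop : top (r q) = false by rewrite /top rqt rqi ltn_eqF.
have lt : ((idx q).+1 < height (tw q))%N.
  rewrite ltn_neqAle idx_lt andbT; apply/negP => tq.
  by have := top_map tq; rewrite ntop.
have [q' [q't q'i]] := floor_ex lt; exists q'.
have := map_up q't q'i; rewrite ntop => -[-> ->].
by split; rewrite ?q't ?q'i ?qi ?rqt ?rqi ?addnS.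
Qed.

Lemma base_ex q : exists e : tower_edges, [/\ rng e = tw q,
  (idx (edge_floor e) + idx (r q))%N = idx q & src e = tw (r q)].
Proof.
move E : (idx (r q)) => i; elim: i q E => [|i IH] q E.
  have [e eq] := edge_floor_ex (introT eqP E : bottom (r q)).
  by exists e; rewrite -eq addn0.
have nb : (0 < idx q)%N.
  rewrite lt0n; apply/negP => bq; case: hr => _ /(_ q bq) + _.
  by rewrite /bottom E.
have [|q' [q't q'i]] := @floor_ex Q (tw q) (idx q).-1.
  by apply: leq_ltn_trans (idx_lt q); rewrite leq_pred.
have := @map_up q' q (esym q't); rewrite q'i prednK // => /(_ erefl).
case: ifP => [_ /eqP b|_ [E1]]; first by rewrite b in E.
rewrite E => -[/esym/IH[e [e1 e2 e3]]]; exists e; split; rewrite ?e1 ?e3 //.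
by rewrite addnS e2 q'i prednK.
Qed.

(** The block that contains the floor [q]. *)
Definition base q : tower_edges := sval (cid (base_ex q)).

Lemma base_rng q : rng (base q) = tw q.
Proof. by rewrite /base; case: cid => e []. Qed.

Lemma base_src q : src (base q) = tw (r q).
Proof. by rewrite /base; case: cid => e []. Qed.

Lemma base_idx q : (idx (edge_floor (base q)) + idx (r q))%N = idx q.
Proof. by rewrite /base; case: cid => e []. Qed.

Lemma base_edge_eq e q : rng e = tw q ->
  idx (edge_floor e) = idx (edge_floor (base q)) -> base q = e.
Proof.
move=> E1 E2; apply/val_inj/floor_eq; last exact: esym E2.
exact: etrans (base_rng q) (esym E1).
Qed.

Lemma base_uniq e q : rng e = tw q ->
  (idx (edge_floor e) <= idx q < idx (edge_floor e) + height (src e))%N ->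
  base q = e /\ idx (r q) = (idx q - idx (edge_floor e))%N.
Proof.
move=> E /andP[l u]; have [|q' [q't q'i rq't rq'i]] := @climb e (idx q - idx (edge_floor e)).
  by lia.
have Eq : q' = q by apply: floor_eq; [rewrite q't|lia].
subst q'; split=> //; apply: base_edge_eq => //.
by have := base_idx q; lia.
Qed.

(** Blocks do not overlap: a block that starts at [q] or below it starts no later
    than the block of [q]. *)
Lemma base_greatest e q : rng e = tw q -> (idx (edge_floor e) <= idx q)%N ->
  (idx (edge_floor e) <= idx (edge_floor (base q)))%N.
Proof.
move=> E l; rewrite leqNgt; apply/negP => lt.
have [||_] := @base_uniq (base q) (edge_floor e); first by rewrite base_rng -E.
  by have := base_idx q; have := idx_lt (r q); rewrite base_src; lia.
by have /eqP -> := bottom_edge_floor e; lia.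
Qed.

Lemma base_same q q' : tw q' = tw q -> idx q' = (idx q).+1 -> ~~ top (r q) ->
  base q' = base q.
Proof.
move=> E1 E2 nt; have := map_up E1 E2; rewrite (negbTE nt) => -[_ E3].
apply: base_edge_eq; first by rewrite base_rng.
by have := base_idx q; have := base_idx q'; lia.
Qed.

Lemma base_minimal q : bottom q -> minimal_edge (base q).
Proof.
move=> /eqP bq; apply/forallP => e; apply/negP => lt.
have := lt; rewrite tower_eltE; last exact: elt_rng lt.
by have := base_idx q; lia.
Qed.

Lemma minimal_bottom q : bottom (r q) -> minimal_edge (base q) -> bottom q.
Proof.
move=> /eqP brq /minimal_edgeP mn; have [q' [q't bq']] := bottom_ex (tw q).
case: hr => _ /(_ q' bq')/edge_floor_ex[e eE] _.
have E : rng e = rng (base q) by rewrite base_rng -q't -eE.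
have := mn e E; rewrite tower_eleE eE => /andP[_]; move: bq'.
by rewrite /bottom => /eqP ->; have := base_idx q; lia.
Qed.

Lemma base_maximal q : top q -> maximal_edge (base q).
Proof.
move=> /eqP tq; apply/forallP => e; apply/negP => lt.
have E := elt_rng lt; move: lt; rewrite tower_eltE //.
have /base_greatest : rng e = tw q by rewrite -E base_rng.
have : (idx (edge_floor e) < height (tw q))%N.
  by rewrite -(base_rng q) E; exact: idx_lt.
by lia.
Qed.

Lemma maximal_top q : top (r q) -> maximal_edge (base q) -> top q.
Proof.
move=> trq mx; apply: contraT => nt.
have [|q' [q't q'i]] := @floor_ex Q (tw q) (idx q).+1.
  by rewrite ltn_neqAle nt idx_lt.
have := map_up q't q'i; rewrite trq => /edge_floor_ex[e eE].
have E : rng e = rng (base q) by rewrite base_rng -q't -eE.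
have := mx => /forallP/(_ e); rewrite tower_eltE // eE.
by have := base_idx q; lia.
Qed.

Lemma base_successor q q' : tw q' = tw q -> idx q' = (idx q).+1 -> top (r q) ->
  successor_edge (base q) (base q').
Proof.
move=> q't q'i trq; have := map_up q't q'i; rewrite trq => /eqP bq'.
have b := base_idx q; have b' := base_idx q'.
have E : rng (base q) = rng (base q') by rewrite !base_rng.
apply/successor_edgeP; split=> [|e lt]; first by rewrite tower_eltE //; lia.
have Ee := elt_rng lt; move: lt; rewrite tower_eltE // => lt.
rewrite tower_eleE -E Ee eqxx /=.
have := @base_greatest e q; rewrite -(base_rng q) => /(_ (esym Ee)).
by lia.
Qed.

End tower_edges.

Section tower_comp.
Context {P Q R : tower_shape}.
Variables (r : floor Q -> floor P) (q : floor R -> floor Q).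
Hypothesis hq : tower_map q.

(** A floor of [R] that starts a [P]-block is determined by the [Q]-block around it
    and by the floor of [Q] over which it lies, itself the start of a [P]-block. The
    order is lexicographic because [Q]-blocks in a tower of [R] do not overlap. *)
Lemma tower_comp_iso :
  edge_iso (tower_edges (r \o q)) (comp_edges (tower_edges r) (tower_edges q)).
Proof.
have P1 (e : tower_edges (r \o q)) : bottom (r (q (edge_floor e))).
  exact: bottom_edge_floor e.
have P2 (e : tower_edges (r \o q)) :
    rng (Sub (q (edge_floor e)) (P1 e) : tower_edges r) == src (base hq (edge_floor e)).
  by rewrite base_src.
pose h e : comp_edges (tower_edges r) (tower_edges q) := Sub (_, _) (P2 e).
have hinj : injective h.
  move=> e e' E; apply/val_inj; rewrite -/(edge_floor _) -/(edge_floor _).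
  have E2 : base hq (edge_floor e) = base hq (edge_floor e').
    exact: (congr1 (fun c => (val c).2) E).
  have E1 : q (edge_floor e) = q (edge_floor e').
    exact: (congr1 (fun c => val (val c).1) E).
  apply: floor_eq; first by rewrite -!(base_rng hq) E2.
  by rewrite -(base_idx hq (edge_floor e)) E2 E1 base_idx.
(* Climb from the start of the Q-block to the prescribed height.              *)
have hsurj c : exists e, h e = c.
  have cE := comp_edge_rng c; set a := (val c).1 in cE *; set b := (val c).2 in cE *.
  have [|p [pt pi qpt qpi]] := @climb _ _ q hq b (idx (edge_floor a)).
    by rewrite -cE; exact: idx_lt.
  have Eqp : q p = edge_floor a by apply: floor_eq => //; rewrite qpt -cE.
  have [|e eE] := @edge_floor_ex _ _ (r \o q) p; first by rewrite /= Eqp; exact: bottom_edge_floor.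
  exists e; apply/val_inj; rewrite [RHS]surjective_pairing; congr pair.
    by apply/val_inj => /=; rewrite eE Eqp.
  rewrite eE; apply: base_edge_eq => //.
  by rewrite -/b; have := base_idx hq p; lia.
have [k kK] := choice hsurj.
exists h; split=> [|e|e|e e'].
- by exists k => // e; apply: hinj; rewrite kK.
- by [].
- exact: base_rng.
rewrite comp_eleE /=.
set b := base hq (edge_floor e); set b' := base hq (edge_floor e').
have Er : rng b = tw (edge_floor e) by exact: base_rng.
have Er' : rng b' = tw (edge_floor e') by exact: base_rng.
have [E|nE] := eqVneq (tw (edge_floor e)) (tw (edge_floor e')); last first.
  have -> : elt b b' = false.
    by apply: contraNF nE => /elt_rng; rewrite Er Er' => ->.
  have -> : (b == b') = false.
    by apply: contraNF nE => /eqP Eb; rewrite -Er -Er' Eb.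
  by rewrite /tower_le (negbTE nE).
have Eb : rng b = rng b' by rewrite Er Er'.
have i := base_idx hq (edge_floor e); have i' := base_idx hq (edge_floor e').
rewrite tower_eltE // /tower_le E eqxx /= -/(edge_floor e) -/(edge_floor e').
have g := @base_greatest _ _ q hq b' (edge_floor e).
have g' := @base_greatest _ _ q hq b (edge_floor e').
have {}g := g (etrans Er' (esym E)); have {}g' := g' (etrans Er E).
have [Ebb|nb] := eqVneq b b'.
  have -> : tw (q (edge_floor e)) = tw (q (edge_floor e')).
    by rewrite -!(base_src hq) -/b -/b' Ebb.
  by rewrite eqxx; move: i i'; rewrite -/b -/b' Ebb ltnn /=; lia.
have ne : idx (edge_floor b) <> idx (edge_floor b').
  by move=> En; case/eqP: nb; apply/val_inj/floor_eq.
by rewrite -/b -/b' in i i' g g'; lia.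
Qed.

End tower_comp.

(** * Codings of a system by towers *)

(** A Kakutani-Rokhlin partition; [code] maps a point to its atom, and the base of
    the partition consists of the points whose atom is a [bottom]. *)
Record coding (X : topologicalType) (phi : X -> X) := Coding {
  coding_shape : tower_shape;
  code :> X -> floor coding_shape;
  code_locally_constant : locally_constant code;
  code_surj : forall p, exists x, code x = p;
  code_follows : forall x, follows (code x) (code (phi x)) }.

Arguments coding_shape {X phi} _.

Section codings.
Context {X : topologicalType} {phi : X -> X}.

Lemma code_top (c : coding phi) x : top (c x) = bottom (c (phi x)).
Proof.
have := code_follows c x; rewrite /follows; case: ifP => [_ ->//|_ /andP[_ /eqP E]].
by rewrite /bottom E.
Qed.

Lemma coding_factor (d : coding phi) (K : Type) (c : X -> K) :
  (forall x y, d x = d y -> c x = c y) -> exists r, forall x, r (d x) = c x.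
Proof.
move=> cd; have [s sK] := choice (@code_surj _ _ d).
by exists (c \o s) => x; apply: cd; rewrite sK.
Qed.

(** A roof of [d] may be followed in [follows] by ground floors that no orbit
    visits next, so this case is settled by the next point of an orbit through
    the roof: it lies in the base of [d], hence in that of [c]. *)
Lemma coding_tower_map (c d : coding phi) (r : floor (coding_shape d) -> floor (coding_shape c)) :
  (forall x, r (d x) = c x) -> (forall x, bottom (d x) -> bottom (c x)) ->
  tower_map r.
Proof.
move=> rd db; split=> [p|q|q q' qq'].
- by have [x <-] := code_surj p; exists (d x).
- by have [x <-] := code_surj q; rewrite rd; exact: db.
have [x xE] := code_surj q; have := code_follows d x; rewrite xE.
move: qq'; rewrite /follows; case: ifP => [_ bq' bx|_ /andP[/eqP e1 /eqP e2]].
  have [x' x'E] := code_surj q'; rewrite -xE -x'E !rd code_top (db _ bx).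
  by apply: db; rewrite x'E.
move=> /andP[/eqP e3 /eqP e4]; have -> : q' = d (phi x).
  by apply: floor_eq; rewrite ?e1 ?e2.
by rewrite -xE !rd; exact: code_follows.
Qed.

End codings.

Definition coding_pullback (X Y : topologicalType) (phi : X -> X) (psi : Y -> Y)
    (alpha : X -> Y) (fa : factor_map phi psi alpha) (c : coding psi) : coding phi.
Proof.
refine (@Coding X phi (coding_shape c) (c \o alpha) _ _ _); case: fa => ca sa ea.
- exact: locally_constant_comp ca (code_locally_constant c).
- by move=> p; have [y <-] := code_surj p; have [x _ <-] := sa y I; exists x.
- by move=> x /=; rewrite ea; exact: code_follows.
Defined.

Definition trivial_shape : tower_shape :=
  @TowerShape unit (fun=> 1%N) (fun=> ltn0Sn 0).

Definition trivial_floor : floor trivial_shape :=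
  Tagged (fun t : tower trivial_shape => 'I_(height t)) (@ord0 0 : 'I_(@height trivial_shape tt)).

Lemma trivial_floor_eq (p q : floor trivial_shape) : p = q.
Proof.
apply: floor_eq; first by case: (tw p) (tw q) => [] [].
by have := idx_lt p; have := idx_lt q; rewrite /=; case: (idx p) (idx q) => [|?] [|?].
Qed.

Definition trivial_coding (X : topologicalType) (phi : X -> X) (x0 : X) : coding phi.
Proof.
refine (@Coding X phi trivial_shape (fun=> trivial_floor) _ _ _).
- by move=> x; exact: filterE.
- by move=> p; exists x0; exact: trivial_floor_eq.
- by move=> x.
Defined.

(** * First return codings *)

Section recurrence.
Context {X : topologicalType}.
Variables (phi phi' : X -> X).
Hypotheses (phiK : cancel phi phi') (phi'K : cancel phi' phi).
Hypotheses (cphi : continuous phi) (cphi' : continuous phi').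
Hypothesis cptX : compact [set: X].
Hypothesis mphi : forall A : set X, closed A -> phi @` A = A -> A = set0 \/ A = [set: X].

Lemma iter_continuous (f : X -> X) n : continuous f -> continuous (iter n f).
Proof.
move=> cf; elim: n => [|n IH] x; first exact: cvg_id.
exact: (continuous_comp (IH x) (cf _)).
Qed.

Lemma iter_cancel (f g : X -> X) m n x : cancel f g -> (m <= n)%N ->
  iter m g (iter n f x) = iter (n - m) f x.
Proof.
move=> fK; elim: m => [|m IH] lt; first by rewrite subn0.
by rewrite iterS IH ?(ltnW lt) // -subnSK //= fK.
Qed.

Variable u : X -> bool.
Hypotheses (lu : locally_constant u).

Lemma iter_locally_constant (f : X -> X) n : continuous f -> locally_constant (u \o iter n f).
Proof. by move=> /(@iter_continuous f n) /locally_constant_comp; apply. Qed.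

Hypothesis (u_neq0 : exists x, u x).

(** The points whose orbit misses [u] form a closed invariant set. *)
Lemma orbit_meets x : exists m, u (iter m phi x) || u (iter m phi' x).
Proof.
pose A := [set x | forall m, ~~ (u (iter m phi x) || u (iter m phi' x))].
have clA : closed A.
  move=> z clz m; have [w [wA]] := clz _
    (filterI (iter_locally_constant m cphi z) (iter_locally_constant m cphi' z)).
  by move=> [/= <- <-]; exact: wA.
have img : phi @` A = A.
  have next z : A z -> A (phi z).
    move=> Az [|m]; first by have := Az 1%N; rewrite /= !negb_or => /andP[->].
    have := Az m.+2; have := Az m; rewrite !iterSr phiK !negb_or.
    by move=> /andP[_ ->] /andP[+ _]; rewrite -iterSr iterSr => ->.
  have prev z : A z -> A (phi' z).
    move=> Az [|m]; first by have := Az 1%N; rewrite /= !negb_or => /andP[_ ->].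
    have := Az m.+2; have := Az m; rewrite !iterSr phi'K !negb_or.
    by move=> /andP[-> _] /andP[_ +]; rewrite -iterSr iterSr => ->.
  apply/seteqP; split=> [_ [z Az <-]|z Az]; first exact: next.
  by exists (phi' z); [exact: prev|exact: phi'K].
case: (mphi clA img) => [A0|AT].
  apply: contrapT => /forallNP nx; have : A x by move=> m; apply/negP/nx.
  by rewrite A0.
have [y uy] := u_neq0; have : A y by rewrite AT.
by move=> /(_ 0%N); rewrite /= uy.
Qed.

(** By compactness two-sided visit times are bounded by some N, and the bound
    applied to the N+1-st iterate of x gives a strictly positive visit time of x;
    in the same way one gets visit times in the past. *)
Lemma recurrence_bound : exists M, forall x,
  (exists m, (0 < m <= M)%N && u (iter m phi x)) /\
  (exists m, (m <= M)%N && u (iter m phi' x)).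
Proof.
have [||N NP] := @compact_exhaust X (fun n x =>
    exists2 m, (m <= n)%N & u (iter m phi x) || u (iter m phi' x)) cptX.
- by move=> m n x mn [i im ui]; exists i => //; exact: leq_trans mn.
- move=> x; have [m um] := orbit_meets x; exists m.
  apply: filterS2 (iter_locally_constant m cphi x) (iter_locally_constant m cphi' x).
  by move=> y /= e1 e2; exists m; rewrite ?e1 ?e2.
exists (N + N.+1)%N => x; split.
  have [m mN /orP[um|um]] := NP (iter N.+1 phi x).
    by exists (m + N.+1)%N; rewrite iterD um andbT; lia.
  exists (N.+1 - m)%N; move: um; rewrite (iter_cancel _ phiK); last exact: leqW.
  by move=> ->; rewrite andbT; lia.
have [m mN /orP[um|um]] := NP (iter N phi' x).
  exists (N - m)%N; move: um; rewrite (iter_cancel _ phi'K) //.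
  by move=> ->; rewrite andbT; lia.
by exists (m + N)%N; rewrite iterD um andbT; lia.
Qed.

End recurrence.

Section first_return.
Context {X : topologicalType}.
Variables (phi : X -> X).
Hypothesis hX : cantor_minimal_system phi.
Variables (K : finType) (G : X -> K) (x0 : X).
Hypothesis lG : locally_constant G.

(** Towers over the clopen set of the points on which [G] takes the value
    [G x0]: a point of this base is followed until its first return, and its
    tower is given by the values of [G] along a window of the orbit that is long
    enough to contain the return. So the return time is a function of the tower,
    and [G] is constant on each floor. *)
Lemma first_return_coding : exists d : coding phi,
  (forall x, bottom (d x) <-> G x = G x0) /\ (forall x y, d x = d y -> G x = G y).
Proof.
have [cX [[phi' [phiK phi'K cphi cphi']] mphi]] := hX.
pose u x := G x == G x0.
have lu : locally_constant u := locally_constant_map (fun k => k == G x0) lG.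
have [|M MP] := recurrence_bound phiK phi'K cphi cphi' (cantor_compact cX) mphi lu.
  by exists x0; exact: eqxx.
have ret_ex x : exists m, (0 < m)%N && u (iter m phi x).
  by have [[m /andP[/andP[m0 _] um]] _] := MP x; exists m; rewrite m0.
have back_ex x : exists m, u (iter m phi' x).
  by have [_ [m /andP[_ um]]] := MP x; exists m.
pose ret x := ex_minn (ret_ex x).
pose back x := ex_minn (back_ex x).
have retP x : [/\ (0 < ret x)%N, u (iter (ret x) phi x), (ret x <= M)%N &
    forall m, (0 < m < ret x)%N -> ~~ u (iter m phi x)].
  rewrite /ret; case: ex_minnP => n /andP[n0 un] nmin; split=> //.
    have [[m /andP[/andP[m0 mM] um]] _] := MP x.
    by apply: leq_trans mM; apply: nmin; rewrite m0.
  move=> m /andP[m0]; rewrite ltnNge; apply: contra => um.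
  by apply: nmin; rewrite m0.
have backP x : [/\ u (iter (back x) phi' x), (back x <= M)%N &
    forall m, (m < back x)%N -> ~~ u (iter m phi' x)].
  rewrite /back; case: ex_minnP => n un nmin; split=> //.
    have [_ [m /andP[mM um]]] := MP x.
    by apply: leq_trans mM; apply: nmin.
  by move=> m; rewrite ltnNge; apply: contra => um; apply: nmin.
have ret_uniq x m : (0 < m)%N -> u (iter m phi x) ->
    (forall i, (0 < i < m)%N -> ~~ u (iter i phi x)) -> ret x = m.
  move=> m0 um mmin; have [r0 ur _ rmin] := retP x.
  have [lt|lt|//] := ltngtP (ret x) m.
    by have := mmin (ret x); rewrite r0 lt ur => /(_ isT).
  by have := rmin m; rewrite m0 lt um => /(_ isT).
have back_uniq x m : u (iter m phi' x) ->
    (forall i, (i < m)%N -> ~~ u (iter i phi' x)) -> back x = m.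
  move=> um mmin; have [ur _ rmin] := backP x.
  have [lt|lt|//] := ltngtP (back x) m.
    by have := mmin _ lt; rewrite ur.
  by have := rmin _ lt; rewrite um.
pose name x := [ffun i : 'I_M.+1 => G (iter i phi x)].
have nameE x i (lti : (i < M.+1)%N) : G (iter i phi x) = name x (Ordinal lti).
  by rewrite ffunE.
have name_ret x y : name x = name y -> ret x = ret y.
  move=> E; have [r0 ur rM rmin] := retP y.
  have Eu i : (i <= M)%N -> u (iter i phi x) = u (iter i phi y).
    by move=> iM; rewrite /u !(nameE _ i iM) E.
  apply: ret_uniq => //; first by rewrite Eu.
  by move=> i /andP[i0 ir]; rewrite Eu ?rmin ?i0 // ltnW // (leq_trans ir).
pose home x := iter (back x) phi' x.
have u_home x : u (home x) by have [] := backP x.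
have iter_home x : iter (back x) phi (home x) = x.
  by rewrite /home iter_cancel // subnn.
have back_lt x : (back x < ret (home x))%N.
  rewrite ltnNge; apply/negP => le; have [r0 ur _ _] := retP (home x).
  have [_ _ bmin] := backP x.
  have := bmin (back x - ret (home x))%N.
  rewrite -(iter_cancel _ phi'K le) -/(home x) ur => H.
  by have : false by apply: H; lia.
(* Only names that occur are towers, so that each tower has a point from which  *)
(* to read its height.                                                         *)
pose tower_pred (w : {ffun 'I_M.+1 -> K}) := `[< exists x, u x /\ name x = w >].
pose T : finType := {w : {ffun 'I_M.+1 -> K} | tower_pred w}.
have rep_ex (t : T) : exists x, u x /\ name x = val t by apply/asboolP/(valP t).
pose rep (t : T) := sval (cid (rep_ex t)).
have repP (t : T) : u (rep t) /\ name (rep t) = val t by rewrite /rep; case: cid.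
pose ht (t : T) := ret (rep t).
have ht0 t : (0 < ht t)%N by have [] := retP (rep t).
pose S := TowerShape ht0.
have homeP x : tower_pred (name (home x)) by apply/asboolP; exists (home x).
pose t_of x : tower S := (Sub (name (home x)) (homeP x) : T).
have ht_of x : height (t_of x) = ret (home x).
  by apply: name_ret; have [_ ->] := repP (t_of x).
have lt_of x : (back x < height (t_of x))%N by rewrite ht_of.
pose c x : floor S := Tagged (fun t : tower S => 'I_(height t)) (Ordinal (lt_of x)).
have c_eq x y : name (home x) = name (home y) -> back x = back y -> c x = c y.
  by move=> e1 e2; apply: floor_eq => //; apply: val_inj.
have c_lc : locally_constant c.
  move=> x; have lb : \forall y \near x, forall i : 'I_M.+1,
      u (iter i phi' y) = u (iter i phi' x).
    by apply: filter_forall => i; exact: (iter_locally_constant lu i cphi').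
  have ln : locally_constant name.
    apply: (@locally_constant_ffun X _ _ (fun (i : 'I_M.+1) z => G (iter i phi z))) => i.
    exact: locally_constant_comp (iter_continuous (n:=i) cphi) lG.
  have {}ln := locally_constant_comp (iter_continuous (n:=back x) cphi') ln.
  apply: filterS2 lb (ln x) => y Eb En.
  have [ub bM bmin] := backP x.
  have Eback : back y = back x.
    apply: back_uniq => [|i lti]; first by rewrite (Eb (Ordinal (bM : (back x < M.+1)%N))).
    have iM : (i < M.+1)%N by lia.
    by rewrite (Eb (Ordinal iM)); exact: bmin.
  by apply: c_eq; rewrite // /home Eback.
have c_surj p : exists x, c x = p.
  have [ur nr] := repP (tw p); set y := rep (tw p) in ur nr.
  have lti := idx_lt p; exists (iter (idx p) phi y).
  have Eback : back (iter (idx p) phi y) = idx p.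
    apply: back_uniq; first by rewrite iter_cancel // subnn.
    move=> i lt; rewrite iter_cancel //; last exact: ltnW.
    by have [_ _ _ rmin] := retP y; apply: rmin; move: lti; rewrite /= /ht -/y; lia.
  apply: floor_eq => //; apply: val_inj => /=.
  by rewrite /home Eback iter_cancel // subnn.
have c_follows x : follows (c x) (c (phi x)).
  have [r0 ur rM rmin] := retP (home x).
  have Ephi : phi x = iter (back x).+1 phi (home x) by rewrite /= iter_home.
  rewrite /follows /top /bottom -[height (tw (c x))]/(height (t_of x)) ht_of.
  rewrite -[idx (c x)]/(back x) -[idx (c (phi x))]/(back (phi x)).
  case: ifP => [/eqP top|/eqP ntop].
    by apply/eqP/back_uniq => //=; rewrite Ephi top.
  have Eback : back (phi x) = (back x).+1.
    have [ub bM bmin] := backP x.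
    apply: back_uniq; first by rewrite iterSr phiK.
    move=> [|i] lti; last by rewrite iterSr phiK; exact: bmin.
    by rewrite [iter 0 _ _]Ephi; apply: rmin; have := back_lt x; lia.
  rewrite Eback eqxx andbT; apply/eqP/val_inj => /=.
  by rewrite /home Eback iterSr phiK.
exists (Coding c_lc c_surj c_follows); split=> [x|x y E].
  rewrite /bottom -[idx _]/(back x); split=> [/eqP b0|ux].
    by have := u_home x; rewrite /home b0 => /eqP.
  by apply/eqP/back_uniq => //; apply/eqP.
have Eb : back x = back y := congr1 (@idx S) E.
have En : name (home x) = name (home y) := congr1 (fun p : floor S => val (tw p)) E.
have [_ bM _] := backP x.
rewrite -(iter_home x) -(iter_home y) -Eb.
by rewrite !(nameE _ _ (bM : (back x < M.+1)%N)) En.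
Qed.

End first_return.

(** After the trivial one, each partition is a first return coding for a map that combines the previous
    partition, one more clopen cut of the space and the prescribed map [a]; the
    base is the fibre of this map through [x0], so that it shrinks to [x0] and
    lies in the base of the previous partition. *)
Lemma coding_sequence (X : topologicalType) (phi : X -> X) (x0 : X)
    (A : nat -> finType) (a : forall n, X -> A n) :
  cantor_minimal_system phi -> (forall n, locally_constant (a n)) ->
  exists D : nat -> coding phi,
  [/\ #|floor (coding_shape (D 0%N))| = 1%N,
      forall n x y, D n.+1 x = D n.+1 y -> D n x = D n y /\ a n.+1 x = a n.+1 y,
      forall n x, bottom (D n.+1 x) -> bottom (D n x) /\ a n.+1 x = a n.+1 x0,
      forall x y, (forall n, D n x = D n y) -> x = y
    & forall x, (forall n, bottom (D n x)) <-> x = x0].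
Proof.
move=> hX la; have [cX _] := hX; have [g [lg gsep]] := cantor_separation cX.
pose G (nc : nat * coding phi) x := (g nc.1 x, nc.2 x, a nc.1.+1 x).
have lG nc : locally_constant (G nc).
  apply: locally_constant_pair; last exact: la.
  apply: locally_constant_pair; first exact: lg.
  exact: code_locally_constant.
have /choice[F FP] nc := first_return_coding hX x0 (lG nc).
pose D := fix D n := if n is m.+1 then F (m, D m) else trivial_coding phi x0.
have DS n : D n.+1 = F (n, D n) by [].
have b0 n : bottom (D n x0).
  case: n => [|n]; first exact: eqxx.
  by rewrite DS; apply/(proj1 (FP _) x0).
exists D; split=> [|n x y|n x|x y E|x].
- apply/eqP; rewrite eqn_leq; apply/andP; split.
    by apply/card_le1_eqP => p q _ _; exact: trivial_floor_eq.
  by apply/card_gt0P; exists (D 0%N x0).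
- by rewrite DS => /(proj2 (FP _))[].
- rewrite DS => /(proj1 (FP _))[_ E ->]; split=> //.
  by rewrite -[(n, D n).2]/(D n) in E; rewrite E.
- by apply: gsep => n; have := E n.+1; rewrite DS => /(proj2 (FP _))[].
- split=> [b|-> //]; apply: gsep => n.
  by have := b n.+1; rewrite DS => /(proj1 (FP _))[].
Qed.

(** * The Bratteli diagram of a sequence of towers *)

Lemma one_floor_eq (S : tower_shape) : #|floor S| = 1%N -> forall p q : floor S, p = q.
Proof. by move=> /eq_leq/card_le1_eqP S1 p q; exact: S1. Qed.

Section tower_diagram.
Variables (P : nat -> tower_shape) (r : forall n, floor (P n.+1) -> floor (P n)).
Hypotheses (hr : forall n, tower_map (@r n)) (h0 : #|floor (P 0%N)| = 1%N).

Lemma floor_inhabited n : exists p : floor (P n), True.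
Proof.
elim: n => [|n [p _]].
  have /card_gt0P[p _] : (0 < #|floor (P 0%N)|)%N by rewrite h0.
  by exists p.
by have [/(_ p)[q _] _ _] := hr n; exists q.
Qed.

Fact tower_diagram_vert_neq0 n : (0 < #|tower (P n)|)%N.
Proof. by have [p _] := floor_inhabited n; apply/card_gt0P; exists (tw p). Qed.

Fact tower_diagram_vert0 : #|tower (P 0%N)| = 1%N.
Proof.
apply/eqP; rewrite eqn_leq tower_diagram_vert_neq0 andbT.
apply/card_le1_eqP => t u _ _.
have [p [<- _]] := bottom_ex t; have [q [<- _]] := bottom_ex u.
by rewrite (one_floor_eq h0 p q).
Qed.

Fact tower_diagram_rng n (v : tower (P n.+1)) :
  exists e : tower_edges (@r n), rng e = v.
Proof.
have [q [<- bq]] := bottom_ex v; have [_ /(_ q bq) brq _] := hr n.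
by have [e <-] := edge_floor_ex brq; exists e.
Qed.

Fact tower_diagram_src n (v : tower (P n)) :
  exists e : tower_edges (@r n), src e = v.
Proof.
have [p [<- bp]] := bottom_ex v; have [/(_ p)[q qE] _ _] := hr n.
by rewrite -qE in bp *; have [e <-] := edge_floor_ex bp; exists e.
Qed.

Fact tower_diagram_edges_neq0 n : (0 < #|tower_edges (@r n)|)%N.
Proof.
have [p _] := floor_inhabited n.+1; have [e _] := tower_diagram_rng (tw p).
by apply/card_gt0P; exists e.
Qed.

Definition tower_diagram : bratteli :=
  @Bratteli (fun n => tower (P n)) (fun n => tower_edges (@r n))
    tower_diagram_vert_neq0 tower_diagram_vert0 tower_diagram_edges_neq0
    tower_diagram_src tower_diagram_rng.

End tower_diagram.

(** Let the partitions [D n] refine each other, separate points and have bases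
    that shrink to [x0]. The points of X are then the infinite paths of the diagram. *)
Section model.
Context {X : topologicalType}.
Variables (phi : X -> X) (D : nat -> coding phi).
Variable r : forall n, floor (coding_shape (D n.+1)) -> floor (coding_shape (D n)).
Arguments r : clear implicits.
Hypotheses (hX : cantor_minimal_system phi) (hr : forall n, tower_map (r n)).
Hypothesis h0 : #|floor (coding_shape (D 0%N))| = 1%N.
Hypothesis rD : forall n x, r n (D n.+1 x) = D n x.
Hypothesis D_sep : forall x y, (forall n, D n x = D n y) -> x = y.
Variable x0 : X.
Hypothesis D_base : forall x, (forall n, bottom (D n x)) <-> x = x0.

Let B := tower_diagram hr h0.

(** The occurrence, in the tower of the level n+1 through x, of the tower of the
    level n through x. *)
Definition itinerary_edge x n : edges B n := base (hr n) (D n.+1 x).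

Lemma itinerary_path x n : rng (itinerary_edge x n) = src (itinerary_edge x n.+1).
Proof. exact: etrans (base_rng _ _) (esym (etrans (base_src _ _) (congr1 tw (rD _ _)))). Qed.

Definition itinerary x : ipath B := IPath (itinerary_path x).

Lemma D_le m n x y : (m <= n)%N -> D n x = D n y -> D m x = D m y.
Proof.
elim: n => [|n IH]; first by rewrite leqn0 => /eqP ->.
rewrite leq_eqVlt => /predU1P[-> //|lt E]; apply: IH => //.
by rewrite -(rD n x) E rD.
Qed.

(** The height of x in its tower of the level n+1 is the sum of the heights of
    its block and of x in this block; so the first n edges determine the atom. *)
Lemma itinerary_code n x y : (forall i, (i < n)%N -> itinerary x i = itinerary y i) ->
  D n x = D n y.
Proof.
elim: n => [_|n IH E]; first exact: (one_floor_eq h0).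
have En : D n x = D n y by apply: IH => i lti; apply: E; exact: ltnW.
have Ee : base (hr n) (D n.+1 x) = base (hr n) (D n.+1 y) := E n (ltnSn n).
apply: floor_eq; first by rewrite -(base_rng (hr n)) Ee base_rng.
by rewrite -(base_idx (hr n) (D n.+1 x)) -(base_idx (hr n) (D n.+1 y)) Ee !rD En.
Qed.

Lemma code_itinerary n x y : D n x = D n y ->
  forall i, (i < n)%N -> itinerary x i = itinerary y i.
Proof. by move=> E i /D_le /(_ E) Ei; rewrite /= /itinerary_edge Ei. Qed.

(** Conversely, every finite path is the itinerary of the points of an atom, which
    is found by climbing each edge to the height reached before. *)
Lemma itinerary_prefix (e : ipath B) n :
  exists2 p : floor (coding_shape (D n)), tw p = src (e n) &
    forall x, D n x = p -> forall i, (i < n)%N -> itinerary x i = e i.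
Proof.
elim: n => [|n [p pe pP]].
  have [p _] := floor_inhabited hr h0 0; exists p => //.
  have [q [<- _]] := bottom_ex (src (e 0%N) : tower (coding_shape (D 0%N))).
  by rewrite (one_floor_eq h0 p q).
have [|q [qt qi rqt rqi]] := @climb _ _ _ (hr n) (e n) (idx p).
  by rewrite -[src _]pe; exact: idx_lt.
exists q; first by rewrite qt -iedge_path.
move=> x xq i; rewrite ltnS leq_eqVlt => /predU1P[->|lti]; last first.
  by apply: pP => //; rewrite -rD xq; apply: floor_eq; rewrite ?rqt.
rewrite /= /itinerary_edge xq; apply: base_edge_eq => //.
by have := base_idx (hr n) q; lia.
Qed.

Lemma itinerary_surj (e : ipath B) : exists x, itinerary x = e.
Proof.
apply: contrapT => /forallNP ne; have [cX _] := hX.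
have [||n nP] := @compact_exhaust X
  (fun n x => exists2 i, (i < n)%N & itinerary x i <> e i) (cantor_compact cX).
- by move=> m n x mn [i im ie]; exists i => //; exact: leq_trans mn.
- move=> x; have [i ie] : exists i, itinerary x i <> e i.
    by apply: contrapT => /forallNP E; apply: (ne x); apply: ipath_ext => i; exact: contrapT.
  exists i.+1; apply: filterS (code_locally_constant (D i.+1) x) => y E.
  by exists i => //; rewrite (code_itinerary E).
have [p _ pP] := itinerary_prefix e n; have [x xp] := code_surj p.
by have [i lti] := nP x; apply; exact: pP.
Qed.

Lemma itinerary_inj : injective itinerary.
Proof. by move=> x y E; apply: D_sep => n; apply: itinerary_code => i _; rewrite E. Qed.

Lemma code_nbhs x (U : set X) : nbhs x U -> exists n, forall y, D n y = D n x -> U y.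
Proof.
move=> xU; have [cX _] := hX.
apply: (@compact_exhaust X (fun n y => D n y = D n x -> U y) (cantor_compact cX)).
  by move=> m n y mn H E; apply: H; exact: D_le E.
move=> y; have [->|ne] := pselect (y = x).
  by exists 0%N; apply: filterS xU.
have [n nE] : exists n, D n y <> D n x.
  by apply: contrapT => /forallNP E; apply: ne; apply: D_sep => n; exact: contrapT.
by exists n; apply: filterS (code_locally_constant (D n) y) => z ->.
Qed.

Lemma itinerary_continuous : continuous itinerary.
Proof.
move=> x U /nbhs_cylinder[n sU].
apply: (@filterS X (nbhs x)) (code_locally_constant (D n) x) => y E.
by apply: sU; exact: code_itinerary E.
Qed.

Lemma itinerary_minimal x : (forall n, bottom (D n x)) -> min_path (itinerary x).
Proof. by move=> b n; exact: base_minimal. Qed.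

Lemma minimal_itinerary x : min_path (itinerary x) -> forall n, bottom (D n x).
Proof.
move=> mn; elim=> [|n bn].
  have [q [_ bq]] := bottom_ex (tw (D 0%N x)).
  by rewrite (one_floor_eq h0 (D 0%N x) q).
by apply: (minimal_bottom (hr := hr n)); [rewrite rD|exact: mn].
Qed.

Lemma top0 x : top (D 0%N x).
Proof.
apply: contraT => nt; have [|q [qt qi]] := @floor_ex _ (tw (D 0%N x)) (idx (D 0%N x)).+1.
  by rewrite ltn_neqAle nt idx_lt.
by have := qi; rewrite (one_floor_eq h0 q (D 0%N x)); lia.
Qed.

Lemma itinerary_maximal x : (forall n, top (D n x)) -> max_path (itinerary x).
Proof. by move=> t n; exact: base_maximal. Qed.

Lemma maximal_itinerary x : max_path (itinerary x) -> forall n, top (D n x).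
Proof.
move=> mx; elim=> [|n tn]; first exact: top0.
by apply: (maximal_top (hr := hr n)); [rewrite rD|exact: mx].
Qed.

(** Let k+1 be the first level at which x is not on a roof. There phi moves x one
    floor up into the next block, which is the successor edge; at lower levels
    phi x is on the ground floor, and at higher levels x and phi x are in the
    same block. *)
Lemma itinerary_vershik x : vershik_rel (itinerary x) (itinerary (phi x)).
Proof.
have [t|/existsNP[n0 nt0]] := pselect (forall n, top (D n x)).
  left; split; first exact: itinerary_maximal.
  by apply: itinerary_minimal => n; rewrite -code_top.
have ex : exists n, ~~ top (D n x) by exists n0; exact/negP.
case: (ex_minnP ex) => -[|k]; first by rewrite top0.
move=> nt kmin; have t i : (i <= k)%N -> top (D i x).
  by move=> ik; apply: contraT => /kmin; lia.
have up n : ~~ top (D n x) ->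
    tw (D n (phi x)) = tw (D n x) /\ idx (D n (phi x)) = (idx (D n x)).+1.
  by have := code_follows (D n) x; rewrite /follows; case: ifP => // _ /andP[/eqP -> /eqP ->].
have [e1 e2] := up _ nt.
have sc : successor_edge (itinerary x k) (itinerary (phi x) k).
  by apply: base_successor => //; rewrite rD; exact: t.
right; exists k; split=> //.
- by move=> i ik; apply: base_maximal; exact: t.
- exact: successor_nmax sc.
- by move=> i ik; apply: base_minimal; rewrite -code_top; exact: t.
have nt' i : (k < i)%N -> ~~ top (D i x).
  elim: i => // i IH; rewrite ltnS leq_eqVlt => /predU1P[<-//|/IH].
  by apply: contra => /(top_map (hr i)); rewrite rD.
move=> i ki; have [e3 e4] := up i.+1 (nt' _ (leqW ki)).
by apply: base_same => //; rewrite rD; exact: nt'.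
Qed.

(** Minimal paths are itineraries of points in all bases, that is, of [x0], and
    maximal paths are itineraries of points that phi sends there. *)
Lemma tower_diagram_model : bv_model B phi.
Proof.
have [cX [[phi' [phiK phi'K _ _]] _]] := hX.
have Bp : properly_ordered B.
  split.
    exists (itinerary (phi' x0)); split=> [|e].
      apply: itinerary_maximal => n; rewrite code_top phi'K.
      exact: (proj2 (D_base x0)).
    have [x <-] := itinerary_surj e; move=> /maximal_itinerary t; congr itinerary.
    rewrite -[x]phiK; congr phi'; apply: esym; apply/D_base => n.
    by rewrite -code_top.
  exists (itinerary x0); split=> [|e].
    by apply: itinerary_minimal; apply/D_base.
  have [x <-] := itinerary_surj e; move=> /minimal_itinerary/D_base -> //.
split=> //; have [g gK] := choice itinerary_surj.
have gK' : cancel itinerary g by move=> x; apply: itinerary_inj; rewrite gK.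
have cg : continuous g.
  move=> e U; rewrite -{1}[e]gK => gU; have [n nU] := code_nbhs gU.
  apply: (@filterS (ipath B) (nbhs e)) (cylinder_nbhs e n) => e' e'E.
  apply: nU; apply: itinerary_code => i lti; rewrite !gK; exact: e'E.
exists g; split; last by exists itinerary; split=> //; exact: itinerary_continuous.
split=> // [x _|e]; first by exists (itinerary x).
rewrite -{1}[e]gK; apply: itinerary_inj; rewrite gK.
apply: (vershik_rel_uniq Bp (vershikP _ Bp)).
exact: itinerary_vershik.
Qed.

End model.

(** * Premorphisms from factor maps *)

(** E_{k,k+1} is E_{k+1}, up to a cast and a composition with the unit. *)
Lemma edges_btwS (B : bratteli) k (kl : (k <= k.+1)%N) :
  edge_iso (edges B k) (edges_btw B kl).
Proof.
rewrite /edges_btw; move: (k.+1 - k)%N (subSnn k) (subnK kl) => _ -> e.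
by rewrite (eq_irrelevance e erefl); exact: comp_id_edge_iso.
Qed.

Section premorphism.
Context {P Q : nat -> tower_shape}.
Variables (r : forall n, floor (P n.+1) -> floor (P n))
  (s : forall n, floor (Q n.+1) -> floor (Q n)) (q : forall n, floor (Q n) -> floor (P n)).
Arguments r : clear implicits.
Arguments s : clear implicits.
Arguments q : clear implicits.
Hypotheses (hr : forall n, tower_map (r n)) (hs : forall n, tower_map (s n))
  (hq : forall n, tower_map (q n)).
Hypotheses (hP : #|floor (P 0%N)| = 1%N) (hQ : #|floor (Q 0%N)| = 1%N).
Hypothesis comm : forall n, r n \o q n.+1 = q n \o s n.

Let B := tower_diagram hr hP.
Let C := tower_diagram hs hQ.

(** By [tower_comp_iso] both composites are the edge set of the map from the
    floors of [Q n.+1] to those of [P n], computed in two ways. *)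
Lemma tower_premorphism : premorphism B C.
Proof.
have rngq n (w : vert C n) : exists e : tower_edges (q n), rng e = w.
  have [x [<- bx]] := @bottom_ex (Q n) w; have [_ /(_ x bx) b _] := hq n.
  by have [e <-] := edge_floor_ex b; exists e.
have neq0 n : (0 < #|tower_edges (q n)|)%N.
  have [x _] := floor_inhabited hs hQ n; have [e _] := rngq n (tw x).
  by apply/card_gt0P; exists e.
refine (@Premorphism B C id erefl leqnSn _ (fun n => tower_edges (q n)) neq0 _ rngq _ _).
- by move=> N; exists N.
- move=> n v; have [p [<- bp]] := @bottom_ex (P n) v; have [/(_ p)[x xE] _ _] := hq n.
  by rewrite -xE in bp *; have [e <-] := edge_floor_ex bp; exists e.
- apply/eqP; rewrite eqn_leq neq0 andbT; apply/card_le1_eqP => e e' _ _.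
  by apply/val_inj/(one_floor_eq hQ).
move=> n; refine (edge_iso_trans _ (comp_edge_iso (tower_edges (q n))
  (edges_btwS C (leqnSn n)))).
refine (edge_iso_trans _ (tower_comp_iso (q n) (hs n))).
by rewrite -comm; apply: edge_iso_sym; exact: tower_comp_iso.
Qed.

End premorphism.

Section factor.
Context {X Y : topologicalType}.
Variables (phi : X -> X) (psi : Y -> Y).
Hypotheses (hX : cantor_minimal_system phi) (hY : cantor_minimal_system psi).

Lemma factor_premorphism (alpha : X -> Y) : factor_map phi psi alpha ->
  exists C B : bratteli,
    [/\ bv_model C phi, bv_model B psi & inhabited (premorphism B C)].
Proof.
move=> fa; have [ca _ _] := fa; have [cX _] := hX.
have [x0 _] := cantor_nonempty cX.
have [DY [Y0 Yref Ybot Ysep Ybase]] := @coding_sequence Y psi (alpha x0)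
  (fun=> unit) (fun _ _ => tt) hY (fun=> fun y => filterE _ (fun=> erefl)).
have [DX [X0 Xref Xbot Xsep Xbase]] := @coding_sequence X phi x0
  (fun n => floor (coding_shape (DY n))) (fun n => DY n \o alpha) hX
  (fun n => locally_constant_comp ca (code_locally_constant (DY n))).
have rP n : exists r : floor (coding_shape (DY n.+1)) -> floor (coding_shape (DY n)),
    forall y, r (DY n.+1 y) = DY n y.
  by apply: coding_factor => y y' /Yref[].
have sP n : exists s : floor (coding_shape (DX n.+1)) -> floor (coding_shape (DX n)),
    forall x, s (DX n.+1 x) = DX n x.
  by apply: coding_factor => x x' /Xref[].
(* Downstairs partitions are compared with upstairs ones after pulling back.   *)
pose pb n := coding_pullback fa (DY n).
have qP n : exists q : floor (coding_shape (DX n)) -> floor (coding_shape (DY n)),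
    forall x, q (DX n x) = DY n (alpha x).
  apply: coding_factor => x x'; case: n => [|n].
    by move=> _; exact: one_floor_eq Y0 _ _.
  by move=> /Xref[].
pose r n := sval (cid (rP n)); pose s n := sval (cid (sP n)); pose q n := sval (cid (qP n)).
have rE n y : r n (DY n.+1 y) = DY n y := svalP (cid (rP n)) y.
have sE n x : s n (DX n.+1 x) = DX n x := svalP (cid (sP n)) x.
have qE n x : q n (DX n x) = DY n (alpha x) := svalP (cid (qP n)) x.
have hr n : tower_map (r n) by apply: coding_tower_map (rE n) _ => y /Ybot[].
have hs n : tower_map (s n) by apply: coding_tower_map (sE n) _ => x /Xbot[].
have hq n : tower_map (q n).
  apply: (@coding_tower_map _ _ (pb n) (DX n)) (qE n) _ => x; case: n => [|n].
    have := proj2 (Ybase (alpha x0)) erefl 0%N.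
    by rewrite (one_floor_eq Y0 (DY 0%N (alpha x0)) (DY 0%N (alpha x))).
  by move=> /Xbot[_ /= ->]; exact: (proj2 (Ybase (alpha x0))).
have comm n : r n \o q n.+1 = q n \o s n.
  apply/functional_extensionality_dep => p /=; have [x <-] := code_surj p.
  by rewrite qE rE sE qE.
exists (tower_diagram hs X0), (tower_diagram hr Y0); split.
- refine (tower_diagram_model hX hs X0 sE Xsep Xbase).
- refine (tower_diagram_model hY hr Y0 rE Ysep Ybase).
- by split; exact: tower_premorphism.
Qed.

End factor.

Theorem theorem4p7 (X Y : topologicalType) (phi : X -> X) (psi : Y -> Y)
    (hX : cantor_minimal_system phi) (hY : cantor_minimal_system psi) :
  (exists alpha : X -> Y, factor_map phi psi alpha) <->
  (exists C B : bratteli,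
      [/\ bv_model C phi, bv_model B psi & inhabited (premorphism B C)]).
Proof.
split=> [[alpha fa]|[C [B [mC mB [f]]]]]; first exact: factor_premorphism fa.
exact: premorphism_factor mC mB f.
Qed.
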